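(* Let $A \in \mathbb{R}^{n \times d}$, $p \in [1,2)$, $k \in \mathbb{N}$, and let $r = O(k \log k)$ if $p = 1$ and $r = O(k \log k (\log\log k)^2)$ otherwise. Let $S \subset [d]$ be the set of column indices returned by the column sampling procedure described in the context (so $|S| = O(r\log d)$), run on $(A,k,p)$ with suitable absolute constants. Let $U = A_S \in \mathbb{R}^{n \times O(r\log d)}$ and let $V = \mathrm{argmin}_{V'} \|UV' - A\|_p$ over $V' \in \mathbb{R}^{|S|\times d}$. Then, with probability $1 - o(1)$, $$\|UV - A\|_p \;\le\; O\!\left(r^{\frac1p - \frac12} (\log k)^{\frac1p}\right) \min_{A_k \text{ of rank at most } k} \|A - A_k\|_p .$$
   Context: For a matrix $M$, $\|M\|_p = (\sum_{i,j}|M_{i,j}|^p)^{1/p}$ (entrywise norm). For $S\subset[d]$, $A_S$ is the submatrix of $A$ formed by the columns indexed by $S$; $A_t$ is the $t$-th column. Logarithms inside asymptotic bounds are read as $\max\{1,\log\}$; $o(1)$ is as $d\to\infty$. Column sampling procedure (input $A,k,p$). Set $T_0=[d]$. For rounds $i = 1,\dots,O(\log d)$: independently repeat for $j=1,\dots,O(\log d)$: draw $S^{(j)}$ uniformly at random among the subsets of $T_{i-1}$ of size $2r$; for every $t\in T_{i-1}\setminus S^{(j)}$ compute $\mathrm{cost}_t=\min_{x\in\mathbb{R}^{2r}}\|A_{S^{(j)}}x-A_t\|_p^p$; let $R^{(j)}$ be the set of the $\Omega(|T_{i-1}\setminus S^{(j)}|)$ (a fixed constant fraction) indices with the smallest costs,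 and let $c_j=\sum_{t\in R^{(j)}}\mathrm{cost}_t$. Let $j^*$ minimize $c_j$; the set $S^{(j^* )}$ is selected in round $i$, and $T_i = T_{i-1}\setminus(S^{(j^* )}\cup R^{(j^* )})$. (If $|T_{i-1}|\le 2r$, all remaining indices are selected and the procedure stops.) The output $S$ is the union of the sets selected over all rounds. *)

(* Defs.v *)
From HB Require Import structures.
From mathcomp Require Import all_boot all_order all_algebra.
From mathcomp Require Import all_classical all_reals all_analysis.

Set Implicit Arguments.
Unset Strict Implicit.
Unset Printing Implicit Defensive.

Import Order.TTheory GRing.Theory Num.Theory.
Import numFieldNormedType.Exports.

Local Open Scope ring_scope.

(** * Matrices *)

Definition pnorm (R : realType) (p : R) (m n : nat) (M : 'M[R]_(m, n)) : R :=
  (\sum_(i < m) \sum_(j < n) `|M i j| `^ p) `^ p^-1.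

Definition colset (R : realType) (n d : nat) (A : 'M[R]_(n, d))
    (S : {set 'I_d}) : 'M[R]_(n, #|S|) :=
  colsub (fun i : 'I_#|S| => enum_val i) A.

(** In [cost] and [opt_rank] the infimum is over a nonempty set bounded below
    by 0, and it is attained; hence it is the minimum. *)
Definition cost (R : realType) (n d : nat) (A : 'M[R]_(n, d)) (p : R)
    (S : {set 'I_d}) (t : 'I_d) : R :=
  inf [set pnorm p (colset A S *m x - col t A) `^ p
      | x in [set: 'cV[R]_#|S|]]%classic.

Definition opt_rank (R : realType) (n d : nat) (A : 'M[R]_(n, d)) (p : R)
    (k : nat) : R :=
  inf [set pnorm p (A - B) | B in [set B : 'M[R]_(n, d) | (\rank B <= k)%N]]%classic.

Definition is_argmin (R : realType) (n d s : nat) (A : 'M[R]_(n, d)) (p : R)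
    (U : 'M[R]_(n, s)) (V : 'M[R]_(s, d)) : Prop :=
  forall V' : 'M[R]_(s, d), pnorm p (U *m V - A) <= pnorm p (U *m V' - A).

(** * Parameters *)

Definition log1 (R : realType) (x : R) : R := Num.max 1 (ln x).

(** Rounding up; only meant for [0 <= x]. *)
Definition nceil (R : realType) (x : R) : nat := `|Num.ceil x|%N.

Definition sample_rank (R : realType) (c p : R) (k : nat) : nat :=
  nceil (c * k%:R * log1 k%:R
         * (if p == 1 then 1 else log1 (log1 k%:R) ^+ 2)).

(** * Discrete distributions, given by their mass functions *)

Section Distributions.
Context {R : realType}.

Definition dret {X : finType} (x : X) : {ffun X -> R} :=
  [ffun y => (y == x)%:R].

Definition dunif {X : finType} (E : {set X}) : {ffun X -> R} :=
  [ffun x => (x \in E)%:R / #|E|%:R].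

Definition dbind {X Y : finType} (mu : {ffun X -> R})
    (f : X -> {ffun Y -> R}) : {ffun Y -> R} :=
  [ffun y => \sum_(x : X) mu x * f x y].

Definition Pr {X : finType} (mu : {ffun X -> R}) (E : X -> Prop) : R :=
  \sum_(x : X | `[< E x >]) mu x.

End Distributions.

(** * Column sampling *)

(** Neither the set of the cheapest indices nor the minimizing repetition is
    unique when costs coincide.  Such choices are made by rules [best] and
    [pick] about which only the following two properties are known: [best T S]
    consists of a fraction [alpha] (rounded up) of [T :\: S] with smallest
    costs, and [pick T D] minimizes the total cost over the draws [D]. *)

Definition best_rule (R : realType) (n d : nat) (A : 'M[R]_(n, d)) (p alpha : R)
    (best : {set 'I_d} -> {set 'I_d} -> {set 'I_d}) : Prop :=
  forall T S : {set 'I_d},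
    [/\ best T S \subset T :\: S,
        #|best T S| = nceil (alpha * #|T :\: S|%:R) &
        forall t u : 'I_d, t \in best T S -> u \in (T :\: S) :\: best T S ->
          cost A p S t <= cost A p S u].

Definition total_cost (R : realType) (n d : nat) (A : 'M[R]_(n, d)) (p : R)
    (best : {set 'I_d} -> {set 'I_d} -> {set 'I_d}) (T S : {set 'I_d}) : R :=
  \sum_(t in best T S) cost A p S t.

Definition pick_rule (R : realType) (n d q : nat) (A : 'M[R]_(n, d)) (p : R)
    (best : {set 'I_d} -> {set 'I_d} -> {set 'I_d})
    (pick : {set 'I_d} -> {ffun 'I_q -> {set 'I_d}} -> 'I_q) : Prop :=
  forall (T : {set 'I_d}) (D : {ffun 'I_q -> {set 'I_d}}) (j : 'I_q),
    total_cost A p best T (D (pick T D)) <= total_cost A p best T (D j).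

(** The possible outcomes of [q] draws of subsets of [T] of size [s].  The
    uniform law on this product set is that of [q] independent uniform draws. *)
Definition draws (d q s : nat) (T : {set 'I_d}) :
    {set {ffun 'I_q -> {set 'I_d}}} :=
  [set D : {ffun 'I_q -> {set 'I_d}} |
    [forall j, (D j \subset T) && (#|D j| == s)]].

(** Law of the output when [m] rounds are left, [T] is the set of remaining
    indices and [S0] is the union of the sets selected so far. *)
Fixpoint sampling_rounds (R : realType) (d q r : nat)
    (best : {set 'I_d} -> {set 'I_d} -> {set 'I_d})
    (pick : {set 'I_d} -> {ffun 'I_q -> {set 'I_d}} -> 'I_q)
    (m : nat) (T S0 : {set 'I_d}) : {ffun {set 'I_d} -> R} :=
  if m is m'.+1 then
    if (#|T| <= 2 * r)%N then dret (S0 :|: T)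
    else dbind (dunif (draws q (2 * r) T)) (fun D =>
      let S := D (pick T D) in
      sampling_rounds R r best pick m' (T :\: (S :|: best T S)) (S0 :|: S))
  else dret S0.

Definition column_sampling (R : realType) (d q r rounds : nat)
    (best : {set 'I_d} -> {set 'I_d} -> {set 'I_d})
    (pick : {set 'I_d} -> {ffun 'I_q -> {set 'I_d}} -> 'I_q) :
    {ffun {set 'I_d} -> R} :=
  sampling_rounds R r best pick rounds [set: 'I_d] finset.set0.

(* Main.v *)
(** Write [A = B + E] with [B] of rank at most [k].

    Let [Q] be a set of [2 * r + 1] columns, with [r >= 768 * k].  A barrier
    argument in the style of Batson, Spielman and Srivastava yields
    a subset of [r] columns of [Q] whose (whitened) Gram matrix dominates
    a constant fraction of that of [Q].  Hence every column of [B] in [Q] is a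
    combination of these [r] columns, with a coefficient matrix of bounded
    operator norm on l2.  Applying this matrix to the rows of [E] and passing from
    l2 to lp by power means costs a factor [r ^ (1 - p / 2)] in p-th powers, so
    the remaining [r + 1] columns of [Q] have small total cost.

    By exchangeability, a uniform set of [2 * r] of the [N] remaining columns
    misses, with constant probability, the [N / (12 * r)] columns with the largest
    errors, and then has small cost on a constant fraction of the others.  The best
    of [O(log d)] repetitions achieves this in all rounds with high probability.
    The column whose error is the [m]-th largest is charged only while [N] is between
    [m / 2] and [12 * r * (m + 1)]; as [N] decreases geometrically this
    happens in [O(log r) = O(log k)] rounds, which gives the factor [log k]. *)

Require Import Defs.
From HB Require Import structures.
From mathcomp Require Import all_boot all_order all_algebra.
From mathcomp Require Import all_classical all_reals all_analysis.
From mathcomp Require Import ring lra zify.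

Set Implicit Arguments.
Unset Strict Implicit.
Unset Printing Implicit Defensive.

Import Order.TTheory GRing.Theory Num.Theory.
Import numFieldNormedType.Exports.

Local Open Scope ring_scope.

(** * Positive definite matrices *)

Section QuadraticForms.
Variables (R : realFieldType) (k : nat).
Implicit Types (X Y : 'M[R]_k) (x y u : 'cV[R]_k).

Definition dotp x y : R := (x^T *m y) 0 0.
Definition qform X x : R := dotp x (X *m x).
Definition posdef X : Prop := X^T = X /\ forall x, x != 0 -> 0 < qform X x.

Lemma dotpE x y : dotp x y = \sum_i x i 0 * y i 0.
Proof. by rewrite /dotp mxE; apply: eq_bigr => i _; rewrite mxE. Qed.

Lemma dotpC x y : dotp x y = dotp y x.
Proof. by rewrite !dotpE; apply: eq_bigr => i _; rewrite mulrC. Qed.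

Lemma dotpDr x y z : dotp x (y + z) = dotp x y + dotp x z.
Proof. by rewrite /dotp mulmxDr mxE. Qed.

Lemma dotpZr a x y : dotp x (a *: y) = a * dotp x y.
Proof. by rewrite /dotp -scalemxAr mxE. Qed.

Lemma dotpDl x y z : dotp (x + y) z = dotp x z + dotp y z.
Proof. by rewrite dotpC dotpDr !(dotpC z). Qed.

Lemma dotpZl a x y : dotp (a *: x) y = a * dotp x y.
Proof. by rewrite dotpC dotpZr dotpC. Qed.

Lemma dotp_mull X x y : dotp (X *m x) y = dotp x (X^T *m y).
Proof. by rewrite /dotp trmx_mul mulmxA. Qed.

Lemma dotp_ge0 x : 0 <= dotp x x.
Proof. by rewrite dotpE sumr_ge0 // => i _; rewrite -expr2 sqr_ge0. Qed.

Lemma dotp_gt0 x : x != 0 -> 0 < dotp x x.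
Proof.
move=> x0; rewrite lt_def dotp_ge0 andbT; apply: contra x0.
rewrite dotpE psumr_eq0 => [/allP h|i _]; last by rewrite -expr2 sqr_ge0.
apply/eqP/colP => i; rewrite mxE; apply/eqP.
by move: (h i (mem_index_enum _)); rewrite -expr2 sqrf_eq0.
Qed.

Lemma qformD X Y x : qform (X + Y) x = qform X x + qform Y x.
Proof. by rewrite /qform mulmxDl dotpDr. Qed.

Lemma qformZ a X x : qform (a *: X) x = a * qform X x.
Proof. by rewrite /qform -scalemxAl dotpZr. Qed.

Lemma qform1 x : qform 1%:M x = dotp x x.
Proof. by rewrite /qform mul1mx. Qed.

Lemma qform_scalar a x : qform a%:M x = a * dotp x x.
Proof. by rewrite -scalemx1 qformZ qform1. Qed.

Lemma outer_mul u x : (u *m u^T) *m x = dotp u x *: u.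
Proof. by rewrite -mulmxA [u^T *m x]mx11_scalar mul_mx_scalar. Qed.

Lemma qform_outer u x : qform (u *m u^T) x = dotp u x ^+ 2.
Proof. by rewrite /qform outer_mul dotpZr (dotpC x) expr2. Qed.

Lemma trace_outer X u : \tr (u *m u^T *m X) = qform X u.
Proof.
by rewrite -mulmxA mxtrace_mulC /mxtrace big_ord1 /qform /dotp mulmxA.
Qed.

Lemma trace_outer_sandwich X u : \tr (X *m u *m (u^T *m X)) = qform (X *m X) u.
Proof. by rewrite mxtrace_mulC /mxtrace big_ord1 /qform /dotp !mulmxA. Qed.

Lemma qform_comb X x y s : X^T = X ->
  qform X (x + s *: y) = qform X x + 2 * s * dotp x (X *m y) + s ^+ 2 * qform X y.
Proof.
move=> symX; rewrite /qform mulmxDr -scalemxAr !dotpDl !dotpDr !dotpZl !dotpZr.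
have -> : dotp y (X *m x) = dotp x (X *m y) by rewrite dotpC dotp_mull symX.
ring.
Qed.

Lemma posdef_ge0 X x : posdef X -> 0 <= qform X x.
Proof.
move=> [_ pX]; have [->|/pX/ltW //] := eqVneq x 0.
by rewrite /qform mulmx0 /dotp mulmx0 mxE.
Qed.

Lemma posdef_unit X : posdef X -> X \in unitmx.
Proof.
move=> [symX pX]; rewrite unitmxE unitfE; apply/negP => /det0P [v v0 vX].
have : 0 < qform X v^T by apply: pX; rewrite trmx_eq0.
by rewrite /qform /dotp trmxK mulmxA vX mul0mx mxE ltxx.
Qed.

Lemma posdef_inv X : posdef X -> posdef (invmx X).
Proof.
move=> pX; have uX := posdef_unit pX; case: (pX) => symX pX'.
have symY : (invmx X)^T = invmx X by rewrite trmx_inv symX.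
split=> // x x0.
have -> : qform (invmx X) x = qform X (invmx X *m x).
  by rewrite /qform mulKVmx // dotp_mull symY.
apply: pX'; apply: contra x0 => /eqP h.
by rewrite -(mulKVmx uX x) h mulmx0.
Qed.

(** Cauchy-Schwarz for the inner product of [X]: with [q = qform (invmx X) u], nonnegativity of the
    form at [x - dotp u x *: (invmx X *m u)] gives [qform X x >= (2 - q) * dotp u x ^+ 2]. *)
Lemma posdef_subouter X u :
  posdef X -> qform (invmx X) u < 1 -> posdef (X - u *m u^T).
Proof.
move=> pX q1; have uX := posdef_unit pX; case: (pX) => symX pX'.
split=> [|x x0]; first by rewrite linearB /= symX trmx_mul trmxK.
rewrite qformD -scaleN1r qformZ qform_outer.
have := posdef_ge0 (x + (- dotp u x) *: (invmx X *m u)) pX.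
rewrite qform_comb // mulKVmx // (dotpC x).
have -> : qform X (invmx X *m u) = qform (invmx X) u.
  by rewrite /qform mulKVmx // dotpC.
have := pX' _ x0.
have [->|d0] := eqVneq (dotp u x) 0; first by lra.
have d2 : 0 < dotp u x ^+ 2 by rewrite exprn_even_gt0.
by nra.
Qed.

Lemma posdef_addouter X u : posdef X -> posdef (X + u *m u^T).
Proof.
move=> [symX pX]; split=> [|x x0]; first by rewrite linearD /= symX trmx_mul trmxK.
by rewrite qformD qform_outer ltr_wpDr ?sqr_ge0 ?pX.
Qed.

Lemma sherman_morrison X u s : X \in unitmx -> 1 + s * qform (invmx X) u != 0 ->
  invmx (X + s *: (u *m u^T)) =
  invmx X - (s / (1 + s * qform (invmx X) u)) *:
              (invmx X *m u *m (u^T *m invmx X)).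
Proof.
move=> uX; set c := 1 + _ => c0.
set Y := invmx X; set Z := Y - _.
have H : (X + s *: (u *m u^T)) *m Z = 1%:M.
  rewrite /Z mulmxBr !mulmxDl mulmxV // -!scalemxAl -!scalemxAr !mulmxA mulmxV //.
  rewrite mul1mx -[u *m u^T *m Y *m u]mulmxA outer_mul.
  rewrite -[_ *: u *m _ *m _]mulmxA -scalemxAl !scalerA.
  set P := u *m (u^T *m Y). rewrite -(mulmxA u u^T Y) -/P.
  have -> : dotp u (Y *m u) = qform Y u by [].
  rewrite -addrA -scalerDl -scalerBl.
  rewrite [X in X *: P](_ : _ = 0) ?scale0r ?addr0 //.
  by rewrite /c in c0 *; field.
have uS : X + s *: (u *m u^T) \in unitmx by case: (mulmx1_unit H).
by rewrite -[RHS]mul1mx -(mulVmx uS) -mulmxA H mulmx1.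
Qed.

(** Expanding the nonnegative form of [X] at [invmx X' *m u - a^-1 *: (invmx X *m u)] shows that
    inversion reverses the Loewner order. *)
Lemma posdef_inv_le X X' a u : posdef X -> posdef X' -> 0 < a ->
  (forall x, a * qform X x <= qform X' x) ->
  a * qform (invmx X') u <= qform (invmx X) u.
Proof.
move=> pX pX' a0 le; have uX := posdef_unit pX; have uX' := posdef_unit pX'.
have [symX _] := pX; set m := qform (invmx X') u.
have Em : qform X' (invmx X' *m u) = m by rewrite /m /qform mulKVmx // dotpC.
have := le (invmx X' *m u); rewrite Em => le1.
have := posdef_ge0 (invmx X' *m u + (- a^-1) *: (invmx X *m u)) pX.
rewrite qform_comb // mulKVmx // (dotpC _ u) -/(qform (invmx X') u) -/m.
have -> : qform X (invmx X *m u) = qform (invmx X) u.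
  by rewrite /qform mulKVmx // dotpC.
set q := qform X _ in le1 *; set w := qform (invmx X) u => h.
have : 0 <= a ^+ 2 * (q + 2 * (- a^-1) * m + (- a^-1) ^+ 2 * w).
  by rewrite mulr_ge0 // sqr_ge0.
have -> : a ^+ 2 * (q + 2 * (- a^-1) * m + (- a^-1) ^+ 2 * w) =
   a * (a * q) - 2 * a * m + w by field; rewrite gt_eqF.
by nra.
Qed.

Lemma mxtrace_qform X : \tr X = \sum_i qform X (delta_mx i 0).
Proof.
apply: eq_bigr => i _; rewrite /qform -colE /dotp trmx_delta.
by rewrite -rowE !mxE.
Qed.

(** Positivity of the form at [x_i e_j - x_j e_i] bounds off-diagonal products by diagonal ones; sum
    over all pairs. The trace thus stands in for the largest eigenvalue. *)
Lemma posdef_qform_le_trace X x : posdef X -> qform X x <= \tr X * dotp x x.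
Proof.
move=> pX; have [symX _] := pX.
have key i j : 2 * (x i 0 * x j 0 * X i j) <= x i 0 ^+ 2 * X j j + x j 0 ^+ 2 * X i i.
  have := posdef_ge0 (x i 0 *: delta_mx j 0 + (- x j 0) *: delta_mx i 0) pX.
  rewrite qform_comb // /qform -!scalemxAr -!colE !dotpZl !dotpZr.
  rewrite /dotp !trmx_delta -!rowE !mxE.
  have : X j i = X i j by rewrite -{1}symX mxE.
  by move=> ->; lra.
have E : qform X x = \sum_i \sum_j x i 0 * x j 0 * X i j.
  rewrite /qform dotpE; apply: eq_bigr => i _; rewrite mxE big_distrr /=.
  by apply: eq_bigr => j _; ring.
have : 2 * qform X x <= \sum_i \sum_j (x i 0 ^+ 2 * X j j + x j 0 ^+ 2 * X i i).
  rewrite E big_distrr ler_sum //= => i _; rewrite big_distrr ler_sum //=.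
have -> : \sum_i \sum_j (x i 0 ^+ 2 * X j j + x j 0 ^+ 2 * X i i) =
          2 * (\tr X * dotp x x).
  under eq_bigr do rewrite big_split.
  rewrite big_split /= [X in _ + X]exchange_big /=.
  have -> : \sum_i \sum_j x i 0 ^+ 2 * X j j = \tr X * dotp x x.
    rewrite exchange_big /mxtrace big_distrl; apply: eq_bigr => j _ /=.
    rewrite dotpE big_distrr; apply: eq_bigr => i _ /=; ring.
  ring.
by lra.
Qed.

(** A bound on the trace of the inverse keeps the least eigenvalue of [X] away from 0; this is read
    off the form at [x - a *: (invmx X *m x)]. *)
Lemma posdef_dot_le X x a : posdef X -> 0 <= a -> \tr (invmx X) * a <= 1 ->
  a * dotp x x <= qform X x.
Proof.
move=> pX a0 Ka; have uX := posdef_unit pX; have [symX _] := pX.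
have := posdef_ge0 (x + (- a) *: (invmx X *m x)) pX.
rewrite qform_comb // mulKVmx //.
have -> : qform X (invmx X *m x) = qform (invmx X) x.
  by rewrite /qform mulKVmx // dotpC.
have := posdef_qform_le_trace x (posdef_inv pX).
have := dotp_ge0 x.
set K := \tr _ in Ka *; set D := dotp _ _; set q := qform X x; set w := qform _ x.
move=> D0 wK h.
have : a ^+ 2 * w <= a ^+ 2 * (K * D) by rewrite ler_wpM2l ?sqr_ge0.
have : (a * D) * (K * a) <= a * D by rewrite ler_piMr // mulr_ge0.
by nra.
Qed.

Lemma posdef_trace_ge0 X : posdef X -> 0 <= \tr X.
Proof. by move=> pX; rewrite mxtrace_qform sumr_ge0 // => i _; exact: posdef_ge0. Qed.

Lemma trace_sq_lower X : X^T = X -> (\tr X) ^+ 2 <= k%:R * \tr (X *m X).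
Proof.
move=> symX.
have H1 : \sum_i X i i ^+ 2 <= \tr (X *m X).
  apply: ler_sum => i _; rewrite mxE (bigD1 i) //= -expr2 lerDl sumr_ge0 // => j _.
  by rewrite -{2}symX mxE -expr2 sqr_ge0.
have H2 : 0 <= \sum_i \sum_j (X i i - X j j) ^+ 2.
  by rewrite sumr_ge0 // => i _; rewrite sumr_ge0 // => j _; rewrite sqr_ge0.
have E : \sum_i \sum_j (X i i - X j j) ^+ 2 =
   2 * (k%:R * \sum_i X i i ^+ 2) - 2 * (\tr X) ^+ 2.
  have -> : \sum_i \sum_j (X i i - X j j) ^+ 2 =
     \sum_i \sum_j (X i i ^+ 2 + X j j ^+ 2 - 2 * (X i i * X j j)).
    by apply: eq_bigr => i _; apply: eq_bigr => j _; ring.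
  under eq_bigr do rewrite sumrB big_split /= sumr_const card_ord -!mulr_sumr -[_ *+ k]mulr_natl.
  rewrite sumrB big_split /= sumr_const card_ord -!mulr_sumr -mulr_suml.
  rewrite -[_ *+ k]mulr_natl /mxtrace; ring.
have : k%:R * \sum_i X i i ^+ 2 <= k%:R * \tr (X *m X) by rewrite ler_wpM2l.
by move: E H2 => -> ; lra.
Qed.

Lemma trace_mulmx_sym X : X^T = X ->
  \tr (X *m X) = \sum_i dotp (X *m delta_mx i 0) (X *m delta_mx i 0).
Proof.
move=> symX; rewrite mxtrace_qform; apply: eq_bigr => i _.
by rewrite dotp_mull symX mulmxA.
Qed.

Lemma trace_inv_sq_upper X : posdef X ->
  \tr (invmx X *m invmx X) <= \tr (invmx X) ^+ 2.
Proof.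
move=> pX; have pY := posdef_inv pX; have uX := posdef_unit pX.
set Y := invmx X; have K0 : 0 <= \tr Y by exact: posdef_trace_ge0.
have [symY _] := pY.
(* The multiplier used below is [(\tr Y)^-1]; a zero trace leaves no basis vector at all. *)
have [Kz|Kp] := eqVneq (\tr Y) 0.
  rewrite Kz expr0n /= trace_mulmx_sym // big1 // => i _.
  have := posdef_qform_le_trace (delta_mx i 0) pY; rewrite -/Y Kz mul0r => h.
  apply/eqP; rewrite eq_le dotp_ge0 andbT leNgt; apply/negP => h2.
  have : delta_mx i 0 != 0 :> 'cV[R]_k.
    by apply/eqP => /colP/(_ i)/eqP; rewrite !mxE !eqxx oner_eq0.
  by case: pY => _ /[apply]; rewrite ltNge h.
rewrite trace_mulmx_sym // expr2 {2}mxtrace_qform big_distrr /=.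
apply: ler_sum => i _.
have Kp' : 0 < \tr Y by rewrite lt_def Kp.
have := @posdef_dot_le X (Y *m delta_mx i 0) (\tr Y)^-1 pX.
rewrite invr_ge0 K0 mulfV // => /(_ isT (lexx _)).
have -> : qform X (Y *m delta_mx i 0) = qform Y (delta_mx i 0).
  by rewrite /qform mulKVmx // dotpC.
by rewrite ler_pdivrMl.
Qed.

End QuadraticForms.

(** * Selecting half of the columns *)

(** [K] is the barrier and [T] the trace of the squared inverse, [K'] and [T'] are their values
    after a removal, [l] is the shift. As [r] dominates both denominators, [gamma <= kappa] amounts
    to [7/8 T - 2 K <= 4 K + T/2], whence [T <= 24 * K]; combine with [K ^+ 2 <= k * T]. *)
Lemma swap_arith (R : realFieldType) (k r K T K' T' l kappa gamma : R) :
  1 <= k -> 768 * k <= r -> -1 <= l <= 8^-1 ->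
  0 <= K -> K <= 48 * k -> 0 <= T -> T <= K ^+ 2 -> K ^+ 2 <= k * T ->
  0 <= kappa -> kappa * (r - k - l * K) = K + l * T ->
  K <= K' -> K' <= K + kappa -> T <= T' ->
  gamma * (r + 2 + (1 - l) * K' - k) = (1 - l) * T' - K' ->
  gamma <= kappa -> K <= 24 * k.
Proof.
move=> k1 rk /andP[l_ge l_le] K0 K_le T0; rewrite !expr2 => T_le T_ge.
move=> kappa0 kd K'_ge K'_le T'_ge gd gk.
have lT : l * T <= 8^-1 * T by rewrite ler_wpM2r.
have lK : l * K <= 8^-1 * K by rewrite ler_wpM2r.
have kap_le : kappa * r <= 2 * K + T / 4.
  have : kappa * (r / 2) <= kappa * (r - k - l * K) by apply: ler_wpM2l; lra.
  by rewrite kd; lra.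
have Kr : 16 * K <= r by lra.
have kap_leK : kappa <= K.
  have : K * (16 * K) <= K * r by rewrite ler_wpM2l.
  have : K * 768 <= K * r by rewrite ler_wpM2l //; lra.
  have : 0 < r by lra.
  move=> r0 h1 h2; rewrite -(ler_pM2r r0); lra.
have K'0 : 0 <= K' by lra.
have lK' : (1 - l) * K' <= 2 * K' by rewrite ler_wpM2r //; lra.
have lK'0 : 0 <= (1 - l) * K' by rewrite mulr_ge0 //; lra.
have gden : gamma * (r + 2 + (1 - l) * K' - k) <= kappa * (2 * r).
  apply: (@le_trans _ _ (kappa * (r + 2 + (1 - l) * K' - k))).
    by rewrite ler_wpM2r //; lra.
  by rewrite ler_wpM2l //; lra.
have lT' : 7 / 8 * T' <= (1 - l) * T' by rewrite ler_wpM2r //; lra.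
have TK : T <= 24 * K by lra.
have : K * K <= K * (24 * k).
  have : k * T <= k * (24 * K) by rewrite ler_wpM2l //; lra.
  by lra.
have [->|Kn0] := eqVneq K 0; first by lra.
by rewrite ler_pM2l // lt_def Kn0.
Qed.

Section FrameSubset.
Variables (R : realFieldType) (I : finType) (k r : nat) (v : I -> 'cV[R]_k).
Variable Q : {set I}.
Implicit Types (S : {set I}) (l : R).

Definition frame S : 'M[R]_k := \sum_(t in S) v t *m (v t)^T.

Lemma sum_qform_frame S X : \sum_(t in S) qform X (v t) = \tr (frame S *m X).
Proof.
rewrite /frame mulmx_suml raddf_sum; apply: eq_bigr => t _.
by rewrite /= trace_outer.
Qed.

Lemma qform_frame S x : qform (frame S) x = \sum_(t in S) dotp (v t) x ^+ 2.
Proof.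
rewrite /qform /frame mulmx_suml /dotp mulmx_sumr summxE; apply: eq_bigr => t _.
exact: qform_outer.
Qed.

Lemma trmx_frame S : (frame S)^T = frame S.
Proof.
by rewrite /frame raddf_sum; apply: eq_bigr => t _; rewrite /= trmx_mul trmxK.
Qed.

Lemma frameD1 S j : j \in S -> frame S = frame (S :\ j) + v j *m (v j)^T.
Proof. by move=> jS; rewrite /frame (big_setD1 j) //= addrC. Qed.

Lemma frameU1 S t : t \notin S -> frame (t |: S) = frame S + v t *m (v t)^T.
Proof. by move=> tS; rewrite /frame big_setU1 //= addrC. Qed.

Definition shifted l S : 'M[R]_k := frame S - l%:M.
(** The lower barrier potential: the sum of [1 / (x - l)] over the eigenvalues [x] of [frame S]. *)
Definition barrier l S : R := \tr (invmx (shifted l S)).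

Hypothesis frameQ : frame Q = 1%:M.
Hypothesis cardQ : #|Q| = (2 * r).+1.
Hypothesis k_gt0 : (0 < k)%N.
Hypothesis k_le_r : (768 * k <= r)%N.

Let admissible l S := [/\ S \subset Q, #|S| = r & posdef (shifted l S)].

(* Removing the best [j] raises the barrier by at most [kappa], adding the best
   [t] then lowers it by at least [gamma]; minimality forces [gamma <= kappa],
   which bounds the trace [T] of the squared inverse linearly in [K], while
   [K ^+ 2 <= k * T]. *)
Lemma barrier_swap_le l S :
  -1 <= l <= 8^-1 -> admissible l S -> barrier l S <= 48 * k%:R ->
  (forall S', admissible l S' -> barrier l S <= barrier l S') ->
  barrier l S <= 24 * k%:R.
Proof.
have r_gt0 : (0 < r)%N by lia.
have r2E : ((2 * r).+1 - r.-1 = r.+2)%N by lia.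
move=> /andP[l_ge l_le] [SQ cardS pX] K_le minS.
set X := shifted l S in pX; set Y := invmx X.
have uX := posdef_unit pX; have pY := posdef_inv pX; rewrite -/Y in pY.
have [symY _] := pY.
set K := \tr Y; set T := \tr (Y *m Y).
have barK : barrier l S = K by [].
rewrite barK in K_le minS *.
have K0 : 0 <= K by exact: posdef_trace_ge0.
have T_le : T <= K ^+ 2 by exact: trace_inv_sq_upper.
have T_ge : K ^+ 2 <= k%:R * T by exact: trace_sq_lower.
have k1 : 1 <= k%:R :> R by rewrite ler1n.
have rk : 768 * k%:R <= r%:R :> R by rewrite -natrM ler_nat.
have T0 : 0 <= T.
  by rewrite /T trace_mulmx_sym // sumr_ge0 // => i _; exact: dotp_ge0.
have XY : X *m Y = 1%:M by rewrite mulmxV.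
have fS : frame S = X + l%:M by rewrite /X /shifted subrK.
have sum1 : \sum_(t in S) qform Y (v t) = k%:R + l * K.
  rewrite sum_qform_frame fS mulmxDl XY mxtraceD mxtrace1.
  by rewrite mul_scalar_mx mxtraceZ.
have sum2 : \sum_(t in S) qform (Y *m Y) (v t) = K + l * T.
  rewrite sum_qform_frame fS mulmxDl mulmxA XY mul1mx mxtraceD.
  by rewrite mul_scalar_mx mxtraceZ.
have qYY u : qform (Y *m Y) u = dotp (Y *m u) (Y *m u).
  by rewrite dotp_mull symY mulmxA.
have KlT0 : 0 <= K + l * T.
  by rewrite -sum2 sumr_ge0 // => t _; rewrite qYY dotp_ge0.
have lK_le : l * K <= 6 * k%:R by nra.
pose den := r%:R - k%:R - l * K.
have den_ge : r%:R / 2 <= den by rewrite /den; lra.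
have den0 : 0 < den by lra.
pose kappa := (K + l * T) / den.
have kappa0 : 0 <= kappa by rewrite divr_ge0 // ltW.
(* Averaging: [kappa] is the ratio of the sums over [S] of [qform (Y *m Y) (v j)] and of
   [1 - qform Y (v j)]. *)
have [j jS jle] : exists2 j, j \in S &
    qform (Y *m Y) (v j) <= kappa * (1 - qform Y (v j)).
  apply/exists_inP; apply: contraT => /exists_inPn h.
  have S0 : S != finset.set0 by rewrite -card_gt0 cardS.
  have : \sum_(t in S) kappa * (1 - qform Y (v t)) <
         \sum_(t in S) qform (Y *m Y) (v t).
    have [j jS] := finset.set0Pn _ S0.
    rewrite [ltLHS](bigD1 j) //= [ltRHS](bigD1 j) //= ltr_leD //.
      by rewrite ltNge h.
    by apply: ler_sum => t /andP[tS _]; rewrite leNgt -leNgt ltW // ltNge h.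
  rewrite -mulr_sumr sumrB sumr_const cardS sum1 sum2.
  by rewrite /kappa opprD addrA -/den mulfVK ?gt_eqF ?ltxx.
set q := qform Y (v j) in jle.
(* If [q >= 1], the choice of [j] forces [Y *m v j = 0], and then [q = 0]. *)
have q1 : q < 1.
  rewrite ltNge; apply/negP => q1.
  have : qform (Y *m Y) (v j) <= 0 by apply: le_trans jle _; nra.
  rewrite qYY leNgt => /negP; apply; apply: dotp_gt0.
  by apply/eqP => h; move: q1; rewrite /q /qform h /dotp mulmx0 mxE ler10.
have q0 : 0 <= q by exact: posdef_ge0.
pose Sj := S :\ j; pose Xj := shifted l Sj.
have XjE : Xj = X + (-1) *: (v j *m (v j)^T).
  by rewrite /Xj /X /shifted (frameD1 jS) scaleN1r addrAC addrK.
have pXj : posdef Xj by rewrite XjE scaleN1r; exact: posdef_subouter.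
have uXj := posdef_unit pXj.
set Yj := invmx Xj; have pYj : posdef Yj by exact: posdef_inv.
have [symYj _] := pYj.
pose z := Y *m v j.
have YjE : Yj = Y + (1 - q)^-1 *: (z *m z^T).
  rewrite /Yj XjE sherman_morrison // -/Y -/q mulN1r ?subr_eq0 1?eq_sym ?lt_eqF //.
  by rewrite /z trmx_mul symY mulN1r scaleNr opprK.
set Kj := \tr Yj; set Tj := \tr (Yj *m Yj).
have a0 : 0 <= (1 - q)^-1 by rewrite invr_ge0 subr_ge0 ltW.
have trz : \tr (z *m z^T) = qform (Y *m Y) (v j).
  by rewrite qYY mxtrace_mulC /mxtrace big_ord1.
have KjE : Kj = K + (1 - q)^-1 * qform (Y *m Y) (v j).
  by rewrite /Kj YjE mxtraceD mxtraceZ trz.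
have Kj_ge : K <= Kj by rewrite KjE lerDl mulr_ge0 // qYY dotp_ge0.
have Kj_le : Kj <= K + kappa.
  by rewrite KjE lerD2l mulrC ler_pdivrMr ?subr_gt0.
have Tj_ge : T <= Tj.
  have -> : Tj = T + (2 * (1 - q)^-1 * qform Y z +
     (1 - q)^-1 ^+ 2 * dotp z z ^+ 2).
    rewrite /Tj YjE mulmxDl !mulmxDr !mxtraceD -!scalemxAl -!scalemxAr !mxtraceZ.
    rewrite [\tr (Y *m (z *m z^T))]mxtrace_mulC !trace_outer qform_outer.
    by rewrite /T; ring.
  rewrite lerDl; apply: addr_ge0; first by rewrite !mulr_ge0 // posdef_ge0.
  by rewrite mulr_ge0 ?sqr_ge0.
pose W := Q :\: Sj.
have SjQ : Sj \subset Q by apply: fintype.subset_trans SQ; exact: finset.subD1set.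
have cardSj : #|Sj| = r.-1 by rewrite -cardS (cardsD1 j S) jS.
have cardW : #|W| = r.+2.
  by rewrite cardsD (finset.setIidPr SjQ) cardQ cardSj.
(* Isotropy of [Q] expresses the frame of the candidates through [Xj], so that the sums over [W]
   become traces of powers of [Yj]. *)
have fW : frame W = (1 - l)%:M - Xj.
  have : frame Q = frame Sj + frame W.
    by rewrite /frame (big_setID Sj) /= (finset.setIidPr SjQ).
  rewrite frameQ /Xj /shifted => h.
  by rewrite raddfB /= h opprB addrA subrK addrC addKr.
have XYj : Xj *m Yj = 1%:M by rewrite mulmxV.
have sum1j : \sum_(t in W) qform Yj (v t) = (1 - l) * Kj - k%:R.
  rewrite sum_qform_frame fW mulmxBl XYj mul_scalar_mx.
  by rewrite linearB /= mxtraceZ mxtrace1.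
have sum2j : \sum_(t in W) qform (Yj *m Yj) (v t) = (1 - l) * Tj - Kj.
  rewrite sum_qform_frame fW mulmxBl (mulmxA Xj) XYj mul1mx mul_scalar_mx.
  by rewrite linearB /= mxtraceZ.
pose den2 := r.+2%:R + (1 - l) * Kj - k%:R.
have den20 : 0 < den2.
  have : 0 <= (1 - l) * Kj by apply: mulr_ge0; lra.
  by rewrite /den2 -addn2 natrD; lra.
pose gamma := ((1 - l) * Tj - Kj) / den2.
(* Averaging again, with [gamma] the ratio of the sums over [W]; [j] itself is a candidate, so [W]
   is nonempty. *)
have [t tW tge] : exists2 t, t \in W &
    gamma * (1 + qform Yj (v t)) <= qform (Yj *m Yj) (v t).
  apply/exists_inP; apply: contraT => /exists_inPn h.
  have : \sum_(t in W) qform (Yj *m Yj) (v t) <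
         \sum_(t in W) gamma * (1 + qform Yj (v t)).
    have jW : j \in W by rewrite !inE eqxx /= (fintype.subsetP SQ).
    rewrite [ltLHS](bigD1 j) //= [ltRHS](bigD1 j) //= ltr_leD //.
      by rewrite ltNge h.
    by apply: ler_sum => t /andP[tS _]; rewrite ltW // ltNge h.
  rewrite -mulr_sumr big_split sumr_const cardW /= sum1j sum2j.
  by rewrite /gamma addrA -/den2 mulfVK ?gt_eqF ?ltxx.
have tQ : t \in Q by move: tW; rewrite inE => /andP[].
have tSj : t \notin Sj by move: tW; rewrite inE => /andP[].
have q'0 : 0 <= qform Yj (v t) by exact: posdef_ge0.
pose S' := t |: Sj.
have XS' : shifted l S' = Xj + 1 *: (v t *m (v t)^T).
  by rewrite /shifted /S' frameU1 // scale1r addrAC.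
have admS' : admissible l S'.
  split; first by rewrite finset.subUset finset.sub1set tQ.
    by rewrite cardsU1 tSj cardSj add1n prednK.
  by rewrite XS' scale1r; exact: posdef_addouter.
have barS' : barrier l S' <= Kj - gamma.
  have c0 : 0 < 1 + qform Yj (v t) by rewrite ltr_pwDl.
  rewrite /barrier XS' sherman_morrison //; last by rewrite mul1r gt_eqF.
  rewrite !mul1r linearB /= mxtraceZ.
  by rewrite trace_outer_sandwich lerD2l lerN2 mulrC ler_pdivlMr.
have gk : gamma <= kappa by have := minS _ admS'; lra.
have hg : gamma * den2 = (1 - l) * Tj - Kj by rewrite mulfVK ?gt_eqF.
apply: (@swap_arith R k%:R r%:R K T Kj Tj l kappa gamma) => //.
- exact/andP.
- by rewrite mulfVK ?gt_eqF.
- by rewrite -hg /den2 -addn2 natrD; congr (_ * _); ring.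
Qed.

Let feasible l := exists2 S, admissible l S & barrier l S <= 48 * k%:R.

(** For a minimizing [S] the barrier is at most [24 * k], so the shifted frame is at least
    [1 / (24 * k)] times the identity. Moving the shift by half of that keeps half of the form, and
    the barrier at most doubles, to [48 * k]. *)
Lemma feasible_step l : -1 <= l <= 8^-1 ->
  feasible l -> feasible (l + (48 * k%:R)^-1).
Proof.
move=> lb [S0 adm0 bar0].
have k1 : 1 <= k%:R :> R by rewrite ler1n.
have [S admS minS] : exists2 S, admissible l S &
    forall S', admissible l S' -> barrier l S <= barrier l S'.
  case: (@arg_minP _ _ _ S0 (fun S => `[< admissible l S >]) (barrier l)).
    exact/asboolP.
  move=> S /asboolP admS minS; exists S => // S' admS'.
  by apply: minS; exact/asboolP.
have barS : barrier l S <= 24 * k%:R.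
  by apply: barrier_swap_le => //; exact: le_trans (minS _ adm0) bar0.
have [SQ cardS pX] := admS.
set a := (48 * k%:R)^-1.
have a0 : 0 < a by rewrite invr_gt0; lra.
have ha : 48 * k%:R * a = 1 by rewrite mulfV // gt_eqF; lra.
have ge2a x : 2 * a * dotp x x <= qform (shifted l S) x.
  apply: posdef_dot_le => //; first by lra.
  by rewrite -/(barrier l S); nra.
have shE : shifted (l + a) S = shifted l S - a%:M.
  by rewrite /shifted raddfD /= opprD addrA.
have qE x : qform (shifted (l + a) S) x = qform (shifted l S) x - a * dotp x x.
  by rewrite shE qformD -scaleN1r qformZ qform_scalar mulN1r.
have pX' : posdef (shifted (l + a) S).
  split=> [|x x0]; first by rewrite linearB /= trmx_frame tr_scalar_mx.
  by rewrite qE; have := ge2a x; have := dotp_gt0 x0; nra.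
exists S => //.
have half x : 2^-1 * qform (shifted l S) x <= qform (shifted (l + a) S) x.
  by rewrite qE; have := ge2a x; lra.
have : 2^-1 * barrier (l + a) S <= barrier l S.
  rewrite /barrier !mxtrace_qform mulr_sumr; apply: ler_sum => i _.
  by apply: posdef_inv_le => //; rewrite invr_gt0.
by lra.
Qed.

(** At a negative shift any [r] columns will do: the shifted frame dominates [1/48] of the
    identity. *)
Lemma feasible_start : feasible (- 48^-1).
Proof.
have [S SQ cardS] : exists2 S : {set I}, S \subset Q & #|S| = r.
  have : (0 < #|[set S : {set I} | S \subset Q & #|S| == r]|)%N.
    by rewrite cards_draws cardQ bin_gt0; lia.
  by rewrite card_gt0 => /finset.set0Pn[S]; rewrite inE => /andP[SQ /eqP]; exists S.
have le x : 48^-1 * qform 1%:M x <= qform (shifted (- 48^-1) S) x.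
  rewrite qform1 /shifted raddfN opprK qformD qform_scalar lerDr qform_frame.
  by rewrite sumr_ge0 // => t _; rewrite sqr_ge0.
have p1 : posdef (1%:M : 'M[R]_k).
  by split=> [|x x0]; rewrite ?tr_scalar_mx // qform1 dotp_gt0.
have pX : posdef (shifted (- 48^-1) S).
  split=> [|x x0]; first by rewrite linearB /= trmx_frame tr_scalar_mx.
  by apply: lt_le_trans (le x); rewrite mulr_gt0 ?invr_gt0 //; apply p1.2.
exists S => //.
have : 48^-1 * barrier (- 48^-1) S <= \tr (invmx (1%:M : 'M[R]_k)).
  rewrite /barrier !mxtrace_qform mulr_sumr; apply: ler_sum => i _.
  by apply: posdef_inv_le => //; rewrite invr_gt0.
by rewrite invmx1 mxtrace1; lra.
Qed.

Lemma feasible_end : feasible 8^-1.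
Proof.
have k1 : 1 <= k%:R :> R by rewrite ler1n.
(* [7 * k] moves of length [1 / (48 * k)] lead from [-1/48] to [6/48 = 1/8]. *)
have h m : (m <= 7 * k)%N -> feasible (- 48^-1 + m%:R * (48 * k%:R)^-1).
  elim: m => [|m IH] mk; first by rewrite mul0r addr0; exact: feasible_start.
  rewrite -[m.+1%:R]natr1 mulrDl mul1r addrA; apply: feasible_step (IH (ltnW mk)).
  have m7 : m%:R <= 7 * k%:R :> R by rewrite -natrM ler_nat ltnW.
  have m0 : 0 <= m%:R :> R by rewrite ler0n.
  have hk : 48 * k%:R * (48 * k%:R)^-1 = 1 :> R by rewrite mulfV // gt_eqF; lra.
  have a0 : 0 < (48 * k%:R)^-1 :> R by rewrite invr_gt0; lra.
  by apply/andP; split; nra.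
have := h _ (leqnn _).
suff -> : - 48^-1 + (7 * k)%:R * (48 * k%:R)^-1 = 8^-1 :> R by [].
by rewrite natrM; field; rewrite gt_eqF //; lra.
Qed.

End FrameSubset.

Lemma frame_subset (R : realFieldType) (I : finType) (k r : nat)
    (v : I -> 'cV[R]_k) (Q : {set I}) :
  frame v Q = 1%:M -> #|Q| = (2 * r).+1 -> (768 * k <= r)%N ->
  exists S : {set I}, [/\ S \subset Q, #|S| = r &
    forall x, dotp x x <= 8 * qform (frame v S) x].
Proof.
case: k v => [|k] v fQ cQ kr.
  have : (0 < #|[set S : {set I} | S \subset Q & #|S| == r]|)%N.
    by rewrite cards_draws cQ bin_gt0; lia.
  rewrite card_gt0 => /finset.set0Pn[S]; rewrite inE => /andP[SQ /eqP cS].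
  by exists S; split=> // x; rewrite /qform !dotpE !big_ord0 mulr0.
have [S [SQ cS pX] _] := feasible_end fQ cQ isT kr.
exists S; split=> // x; have := posdef_ge0 x pX.
rewrite qformD -scaleN1r qformZ qform_scalar; lra.
Qed.

(** * Interpolating the columns of a low-rank matrix *)

Lemma orthonormal_factor (R : rcfType) (k d : nat) (V : 'M[R]_(k, d)) :
  exists k' (C : 'M[R]_(k, k')) (H : 'M[R]_(k', d)) (D : 'M[R]_(k', k)),
    [/\ (k' <= k)%N, V = C *m H, H = D *m V & H *m H^T = 1%:M].
Proof.
elim: k V => [|m IH] V.
  exists 0%N, 0, 0, 0; split=> //; by apply/matrixP => -[].
move: V; rewrite -[m.+1]/(1 + m)%N => V; rewrite -[V]vsubmxK.
set v := usubmx V; set W := dsubmx V.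
have [k' [C [H [D [k'k WE HE HH]]]]] := IH W.
(* Gram-Schmidt: the residual of the new row. If zero, it adds no row to [H]; otherwise it is
   normalized by [s]. *)
pose u := v - v *m H^T *m H.
have vE : v = v *m H^T *m H + u by rewrite addrC subrK.
have uH : u *m H^T = 0 by rewrite mulmxBl -[_ *m H *m H^T]mulmxA HH mulmx1 subrr.
have [u0|u0] := eqVneq u 0.
  exists k', (col_mx (v *m H^T) C), H, (row_mx 0 D); split=> //.
  - exact: leq_trans k'k _.
  - by rewrite mul_col_mx -WE {1}vE u0 addr0.
  - by rewrite mul_row_col mul0mx add0r.
pose n2 := (u *m u^T) 0 0.
have n20 : 0 < n2.
  have := @dotp_gt0 _ _ u^T; rewrite /dotp trmxK; apply.
  by rewrite trmx_eq0.
have uu : u *m u^T = n2%:M by rewrite [LHS]mx11_scalar.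
pose s := (Num.sqrt n2)^-1.
have s0 : s != 0 by rewrite invr_eq0 sqrtr_eq0 -ltNge.
have s2 : s * (s * n2) = 1.
  rewrite mulrA -expr2 exprVn sqr_sqrtr ?ltW // mulVf //; exact: lt0r_neq0.
exists (1 + k')%N, (block_mx s^-1%:M (v *m H^T) 0 C), (col_mx (s *: u) H),
  (block_mx s%:M (- s *: (v *m H^T *m D)) 0 D); split => //.
- rewrite mul_block_col mul0mx add0r -WE; congr col_mx.
  by rewrite mul_scalar_mx scalerA mulVf // scale1r {1}vE addrC.
- rewrite mul_block_col mul0mx add0r -HE; congr col_mx.
  rewrite mul_scalar_mx -scalemxAl scaleNr -scalerBr; congr (_ *: _).
  by rewrite -(mulmxA _ D) -HE.
- have suH : s *: u *m H^T = 0 by rewrite -scalemxAl uH scaler0.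
  rewrite tr_col_mx mul_col_row HH suH.
  have -> : H *m (s *: u)^T = 0.
    by rewrite -[H]trmxK -trmx_mul suH trmx0.
  rewrite linearZ /= -scalemxAl -scalemxAr uu.
  by rewrite -[n2%:M]scalemx1 !scalerA -mulrA s2 scale1r -scalar_mx_block.
Qed.

Lemma column_interpolation (R : rcfType) (n d k r : nat) (B : 'M[R]_(n, d))
    (Q : {set 'I_d}) :
  (\rank B <= k)%N -> #|Q| = (2 * r).+1 -> (768 * k <= r)%N ->
  exists (S : {set 'I_d}) (X : 'I_d -> 'I_d -> R),
    [/\ S \subset Q, #|S| = r,
        forall i t, t \in Q -> B i t = \sum_(j in S) X j t * B i j &
        forall w : 'I_d -> R, \sum_(t in Q) (\sum_(j in S) w j * X j t) ^+ 2
                              <= 8 * \sum_(j in S) w j ^+ 2].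
Proof.
move=> rB cQ kr.
(* Row coordinates of [B] with the columns outside [Q] set to zero; orthonormalizing the rows makes
   the columns in [Q] isotropic, as [frame_subset] requires. *)
pose V := row_base B *m diag_mx (\row_j (j \in Q)%:R).
have VE i j : V i j = row_base B i j * (j \in Q)%:R.
  by rewrite /V mul_mx_diag !mxE.
have [k' [C [H [D [k'k VC HD HH]]]]] := orthonormal_factor V.
pose v t := col t H.
have fQ : frame v Q = 1%:M.
  rewrite -HH; apply/matrixP => a b; rewrite summxE !mxE.
  rewrite [RHS](bigID (mem Q)) /= [X in _ = _ + X]big1 ?addr0 => [|t tQ].
    by apply: eq_bigr => t _; rewrite !mxE big_ord1 !mxE.
  (* Since [H = D *m V], columns zeroed in [V] are zero in [H] too. *)
  rewrite HD !mxE big1 ?mul0r // => i _.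
  by rewrite VE (negbTE tQ) mulr0 mulr0.
have [|S [SQ cS ge]] := frame_subset fQ cQ (r := r).
  by move: rB k'k kr; lia.
have pM : posdef (frame v S).
  by split=> [|x x0]; [exact: trmx_frame|have := ge x; have := dotp_gt0 x0; lra].
have uM := posdef_unit pM; set W := invmx (frame v S).
have [symW _] := posdef_inv pM; rewrite -/W in symW.
(* Inverting the frame of [S] gives the interpolation coefficients. *)
have vE t : v t = \sum_(j in S) dotp (v j) (W *m v t) *: v j.
  rewrite -[LHS](mulKVmx uM) /frame mulmx_suml; apply: eq_bigr => j _.
  exact: outer_mul.
have BE i t : t \in Q -> B i t = ((col_base B *m C) *m v t) i 0.
  move=> tQ; rewrite /v colE mulmxA -colE mxE -mulmxA -VC -{1}[B]mulmx_base !mxE.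
  by apply: eq_bigr => j _; rewrite VE tQ mulr1.
exists S, (fun j t => dotp (v j) (W *m v t)); split=> //.
  move=> i t tQ; rewrite BE // {1}(vE t) mulmx_sumr summxE.
  apply: eq_bigr => j jS; rewrite -scalemxAr mxE BE //; exact: (fintype.subsetP SQ).
move=> w; pose z := \sum_(j in S) w j *: v j; pose y := W *m z.
have dz x : dotp z x = \sum_(j in S) w j * dotp (v j) x.
  rewrite /dotp linear_sum mulmx_suml summxE; apply: eq_bigr => j _.
  exact: dotpZl.
have -> : \sum_(t in Q) (\sum_(j in S) w j * dotp (v j) (W *m v t)) ^+ 2 =
          dotp y y.
  rewrite -qform1 -fQ qform_frame; apply: eq_bigr => t _; congr (_ ^+ 2).
  by rewrite -dz [RHS]dotpC /y dotp_mull symW.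
apply: le_trans (ge y) _; rewrite ler_wpM2l //.
have Fy : frame v S *m y = z by rewrite /y mulKVmx.
have q1 : qform (frame v S) y = \sum_(j in S) w j * dotp (v j) y.
  by rewrite /qform Fy dotpC dz.
have q2 := qform_frame v S y.
(* By [q1] and [q2] the cross term and the last term are the same form, so this expands to the sum
   of the [w j ^+ 2] minus that form. *)
have : 0 <= \sum_(j in S) (w j - dotp (v j) y) ^+ 2.
  by apply: sumr_ge0 => j _; exact: sqr_ge0.
have -> : \sum_(j in S) (w j - dotp (v j) y) ^+ 2 =
  \sum_(j in S) w j ^+ 2 - 2 * \sum_(j in S) w j * dotp (v j) y +
  \sum_(j in S) dotp (v j) y ^+ 2.
  by rewrite mulr_sumr -sumrB -big_split; apply: eq_bigr => j _ /=; ring.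
by rewrite -q1 -q2; lra.
Qed.

(** * Counting the good samples of a round *)

Section Counting.
Variables (R : realFieldType) (I : finType).
Implicit Types (S T Q H : {set I}).

Definition subsets_of_size (s : nat) T := [set S : {set I} | (S \subset T) && (#|S| == s)].

(** Inserting [t] into [S] is a bijection from pairs [(S, t)] with [t] outside [S] to pairs [(Q, t)]
    with [t] in [Q]. *)
Lemma sum_insert_point (F : {set I} -> I -> R) T s :
  \sum_(S in subsets_of_size s T) \sum_(t in T :\: S) F (t |: S) t =
  \sum_(Q in subsets_of_size s.+1 T) \sum_(t in Q) F Q t.
Proof.
rewrite !pair_big_dep /=.
rewrite (reindex_onto (fun q : {set I} * I => (q.1 :\ q.2, q.2))
                      (fun q : {set I} * I => (q.2 |: q.1, q.2))) /=.
  apply: eq_big => [[Q t]|[Q t]] /=; rewrite !inE xpair_eqE eqxx andbT.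
    have [tQ|tQ] := boolP (t \in Q); last first.
      rewrite [RHS]andbF; apply/negbTE/negP => /andP[_ /eqP E].
      by rewrite -E finset.setU11 in tQ.
    rewrite finset.setD1K // eqxx andbT /= !andbT (cardsD1 t Q) tQ add1n eqSS.
    rewrite finset.subDset; case: eqP => _; last by rewrite !andbF.
    rewrite !andbT; apply/andP/idP => [[h tT]|h].
      by apply: fintype.subset_trans h _; rewrite finset.subUset finset.sub1set tT subxx.
    by rewrite (fintype.subset_trans h (finset.subsetUr _ _)) (fintype.subsetP h).
  by move=> /andP[_ /eqP ->].
move=> [S t] /=; rewrite !inE => /andP[_ /andP[tS _]].
by rewrite finset.setU1K.
Qed.

Lemma natr_card_sum (A : {set {set I}}) (P : pred {set I}) :
  #|[set S in A | P S]|%:R = \sum_(S in A) (P S)%:R :> R.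
Proof.
rewrite -sum1_card natr_sum big_mkcond [RHS]big_mkcond /=.
by apply: eq_bigr => S _; rewrite !inE; case: (S \in A); case: (P S).
Qed.

Variables (T H : {set I}) (r : nat) (c : {set I} -> I -> R) (e : I -> R) (D : R).
Hypotheses (c_ge0 : forall S t, 0 <= c S t) (e_ge0 : forall t, 0 <= e t).
Hypotheses (D_ge0 : 0 <= D) (r_gt0 : (0 < r)%N) (T_gt : (2 * r < #|T|)%N).
Hypothesis H_small : (12 * r * #|H| <= #|T|)%N.
Hypothesis half_cheap : forall Q, Q \subset T -> #|Q| = (2 * r).+1 ->
  exists2 S : {set I}, S \subset Q /\ #|S| = r &
    \sum_(t in Q :\: S) c (Q :\ t) t <= D * \sum_(j in Q) e j.

(** By exchangeability of [S] and [t], the pair [(S, t)] can be drawn as a set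
    [Q] of size [2 * r + 1] and a point [t] of it. *)
Lemma many_cheap_subsets :
  (#|subsets_of_size (2 * r) T| <=
   16 * #|[set S in subsets_of_size (2 * r) T |
     [exists G : {set I}, [&& G \subset T :\: S, #|T :\: S| <= 8 * #|G| &
       (\sum_(t in G) c S t <= 16 * D * \sum_(j in T :\: H) e j)%R]]]|)%N.
Proof.
set Sub := subsets_of_size (2 * r) T; set Sub' := subsets_of_size (2 * r).+1 T.
have [f fP] : exists f : {set I} -> {set I}, forall Q, Q \in Sub' ->
    [/\ f Q \subset Q, #|f Q| = r &
        \sum_(t in Q :\: f Q) c (Q :\ t) t <= D * \sum_(j in Q) e j].
  pose P Q (S : {set I}) := [&& S \subset Q, #|S| == r &
     \sum_(t in Q :\: S) c (Q :\ t) t <= D * \sum_(j in Q) e j].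
  exists (fun Q => odflt finset.set0 [pick S | P Q S]) => Q; rewrite inE => /andP[QT /eqP cQ].
  case: pickP => [S /and3P[? /eqP ? ?] //|h].
  have [S [SQ /eqP cS] le] := half_cheap QT cQ.
  by have := h S; rewrite /P SQ cS le.
(* Good pairs: [Q] avoids [H] and [t] lies outside the chosen half [f Q]. [G S] collects the points
   forming a good pair with [S]. *)
pose g (Q : {set I}) t := (t \notin f Q) && [disjoint Q & H].
pose G S := [set t in T :\: S | g (t |: S) t].
pose M : R := (#|T| - 2 * r)%:R.
have M_gt0 : 0 < M by rewrite ltr0n subn_gt0.
have cTS S : S \in Sub -> #|T :\: S| = (#|T| - 2 * r)%N.
  by rewrite inE => /andP[ST /eqP cS]; rewrite cardsD (finset.setIidPr ST) cS.
pose e' := \sum_(j in T :\: H) e j.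
have e'0 : 0 <= e' by apply: sumr_ge0.
have GcardE S : #|G S|%:R = \sum_(t in T :\: S) (g (t |: S) t)%:R :> R.
  rewrite -sum1_card natr_sum big_mkcond [RHS]big_mkcond /=.
  by apply: eq_bigr => t _; rewrite /G !inE; case: (t \in S); case: (t \in T); case: (g _ _).
have sumQ : \sum_(Q in Sub') (2 * r).+1%:R = \sum_(S in Sub) M.
  have := sum_insert_point (fun _ _ => 1) T (2 * r); rewrite -/Sub -/Sub'.
  under eq_bigr => S SS do rewrite sumr_const cTS //.
  under [RHS]eq_bigr => Q.
    rewrite inE => /andP[_ /eqP cQ]; rewrite sumr_const cQ; over.
  by move=> ->.
(* Union bound: a [Q] meeting [H] arises from some [S] by inserting a point of [H]. *)
have badQ : \sum_(Q in Sub') (~~ [disjoint Q & H])%:R <= \sum_(S in Sub) #|H|%:R :> R.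
  apply: (@le_trans _ _ (\sum_(Q in Sub') \sum_(t in Q) (t \in H)%:R)).
    apply: ler_sum => Q _; have [_|] := boolP [disjoint Q & H].
      by apply: sumr_ge0 => t _; rewrite ler0n.
    rewrite -finset.setI_eq0 => /finset.set0Pn[t]; rewrite inE => /andP[tQ tH].
    by rewrite (bigD1 t) //= tH lerDl; apply: sumr_ge0 => u _; rewrite ler0n.
  rewrite -sum_insert_point; apply: ler_sum => S _.
  rewrite -sum1_card natr_sum [leLHS]big_mkcond [leRHS]big_mkcond /=.
  by apply: ler_sum => t _; case: (_ \in _); case: (_ \in H); rewrite ?ler01.
(* Each [Q] avoiding [H] supplies [r + 1] good points, over half of its points; the sets meeting [H]
   lose at most [1/5] of all pairs, and [1/2 - 1/5 = 3/10]. *)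
have sumG : 3 / 10 * M * #|Sub|%:R <= \sum_(S in Sub) #|G S|%:R.
  under [leRHS]eq_bigr => S _ do rewrite GcardE.
  rewrite (sum_insert_point (fun Q t => (g Q t)%:R)).
  apply: (@le_trans _ _ (\sum_(Q in Sub') r.+1%:R * (1 - (~~ [disjoint Q & H])%:R))).
    rewrite -mulr_sumr sumrB.
    have : r.+1%:R * \sum_(Q in Sub') (~~ [disjoint Q & H])%:R <=
           r.+1%:R * \sum_(S in Sub) #|H|%:R :> R by rewrite ler_wpM2l.
    rewrite sumr_const -mulr_natr mulrBr; move: sumQ; rewrite !sumr_const.
    rewrite -[_ *+ #|Sub'|]mulr_natr -[M *+ _]mulr_natr => E.
    rewrite -mulr_natr => h.
    have h5 : 5 * (r.+1%:R * #|H|%:R) <= M.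
      rewrite /M -!natrM ler_nat; move: H_small T_gt r_gt0.
      by case: #|H| => [|h']; [rewrite !muln0 | nia].
    have E2 : (2 * r).+1%:R = 2 * r.+1%:R - 1 :> R.
      by rewrite -!natr1 natrM; ring.
    have s0 : 0 <= #|Sub|%:R :> R by [].
    have s0' : 0 <= #|Sub'|%:R :> R by [].
    have : 5 * (r.+1%:R * #|H|%:R) * #|Sub|%:R <= M * #|Sub|%:R by rewrite ler_wpM2r.
    rewrite E2 in E; lra.
  apply: ler_sum => Q QS; have [fQ cf _] := fP Q QS.
  have [dQ|dQ] := boolP [disjoint Q & H]; last first.
    by rewrite subrr mulr0; apply: sumr_ge0 => t _; rewrite ler0n.
  rewrite subr0 mulr1.
  have -> : r.+1%:R = \sum_(t in Q :\: f Q) 1 :> R.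
    rewrite sumr_const cardsD (finset.setIidPr fQ) cf.
    by move: QS; rewrite inE => /andP[_ /eqP ->]; congr (_%:R); lia.
  rewrite big_mkcond [leRHS]big_mkcond /=; apply: ler_sum => t _.
  by rewrite !inE /g dQ andbT; case: (t \in Q); case: (t \in f Q).
have sumC : \sum_(S in Sub) \sum_(t in G S) c S t <= #|Sub|%:R * (D * e').
  have -> : \sum_(S in Sub) \sum_(t in G S) c S t =
    \sum_(S in Sub) \sum_(t in T :\: S) (g (t |: S) t)%:R * c ((t |: S) :\ t) t.
    apply: eq_bigr => S _; rewrite big_mkcond [RHS]big_mkcond /=.
    apply: eq_bigr => t _; rewrite inE /=; have [|//] := boolP (t \in T :\: S).
    rewrite inE => /andP[tS _]; rewrite finset.setU1K //.
    by case: (g _ _); rewrite ?mul1r ?mul0r.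
  rewrite (sum_insert_point (fun Q t => (g Q t)%:R * c (Q :\ t) t)).
  apply: (@le_trans _ _ (\sum_(Q in Sub') D * \sum_(t in Q) (t \notin H)%:R * e t)).
    apply: ler_sum => Q QS; have [fQ cf cle] := fP Q QS.
    have [dQ|dQ] := boolP [disjoint Q & H]; last first.
      rewrite big1 => [|t _]; last by rewrite /g (negbTE dQ) andbF mul0r.
      rewrite mulr_ge0 //; apply: sumr_ge0 => t _; rewrite mulr_ge0 //; exact: ler0n.
    have -> : \sum_(t in Q) (t \notin H)%:R * e t = \sum_(t in Q) e t.
      by apply: eq_bigr => t tQ; rewrite (disjointFr dQ tQ) mul1r.
    apply: le_trans cle; rewrite big_mkcond [leRHS]big_mkcond /=.
    apply: ler_sum => t _; rewrite !inE /g dQ andbT.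
    by case: (t \in Q); case: (t \in f Q); rewrite ?mul0r ?mul1r.
  rewrite -mulr_sumr -(sum_insert_point (fun _ t => (t \notin H)%:R * e t)).
  rewrite mulrCA ler_wpM2l // mulr_natl -sumr_const.
  apply: ler_sum => S _; rewrite big_mkcond [leRHS]big_mkcond /=.
  apply: ler_sum => t _; rewrite !inE.
  by case: (t \in S); case: (t \in H); case: (t \in T); rewrite /= ?mul0r ?mul1r.
(* [a] holds for at least [1/8] of the draws, as [3/10 - 1/8 >= 1/8], and by Markov's inequality [b]
   fails for at most [1/16]; both hold for at least [1/16]. *)
pose a S := (#|T :\: S| <= 8 * #|G S|)%N.
pose b S := \sum_(t in G S) c S t <= 16 * D * e'.
have cntA : #|Sub|%:R / 8 <= \sum_(S in Sub) (a S)%:R :> R.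
  have : \sum_(S in Sub) #|G S|%:R <= \sum_(S in Sub) (M * (a S)%:R + M / 8).
    apply: ler_sum => S SS; rewrite /a.
    have GT : (#|G S| <= #|T| - 2 * r)%N.
      rewrite -(cTS S SS) subset_leq_card // /G.
      by apply/fintype.subsetP => t; rewrite inE => /andP[].
    rewrite (cTS S SS); case: leqP => h.
      by rewrite mulr1 ler_wpDr ?divr_ge0 ?(ltW M_gt0) // ler_nat.
    rewrite mulr0 add0r ler_pdivlMr // -natrM ler_nat mulnC; exact: ltnW.
  rewrite big_split /= -mulr_sumr sumr_const -[_ *+ #|Sub|]mulr_natr => h.
  have : M * (#|Sub|%:R / 8) <= M * \sum_(S in Sub) (a S)%:R.
    have : 0 <= M * #|Sub|%:R by rewrite mulr_ge0 // ltW.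
    lra.
  by rewrite (ler_pM2l M_gt0).
have cntB : \sum_(S in Sub) (~~ b S)%:R <= #|Sub|%:R / 16 :> R.
  have cG0 S : 0 <= \sum_(t in G S) c S t by apply: sumr_ge0.
  have [De0|Den] := eqVneq (D * e') 0.
    rewrite big1 ?divr_ge0 // => S SS; rewrite /b -mulrA De0 mulr0.
    move: sumC; rewrite De0 mulr0 => h.
    have -> : \sum_(t in G S) c S t = 0; last by rewrite lexx.
    apply/eqP; rewrite eq_le cG0 andbT; apply: le_trans h.
    by rewrite [leRHS](bigD1 S) //= lerDl; apply: sumr_ge0.
  have De_gt0 : 0 < D * e' by rewrite lt_def Den mulr_ge0.
  rewrite -(ler_pM2l De_gt0) mulr_sumr.
  apply: (@le_trans _ _ ((\sum_(S in Sub) \sum_(t in G S) c S t) / 16)); last first.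
    by rewrite mulrA [D * e' * _]mulrC ler_wpM2r ?invr_ge0.
  rewrite mulr_suml; apply: ler_sum => S _; rewrite ler_pdivlMr //.
  case: (boolP (b S)) => [_|]; first by rewrite mulr0 mul0r.
  by rewrite /b -ltNge => /ltW h; rewrite mulr1 mulrC mulrA.
rewrite -(ler_nat R) natrM natr_card_sum.
apply: (@le_trans _ _ (16 * \sum_(S in Sub) ((a S)%:R - (~~ b S)%:R))).
  by rewrite sumrB; lra.
rewrite ler_wpM2l //; apply: ler_sum => S SS.
case: existsP => [_|h].
  by case: (a S); case: (b S) => /=; lra.
case aS : (a S); case bS : (b S) => /=; try lra.
case: h; exists (G S); rewrite -/(a S) aS -/e' -/(b S) bS !andbT.
by apply/fintype.subsetP => t; rewrite inE => /andP[].
Qed.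

End Counting.

(** * Charging the errors to the rounds *)

Section SortedValues.
Variables (R : realType) (I : finType) (e : I -> R).
Hypothesis e_ge0 : forall j, 0 <= e j.

(** Decreasing errors; positions in one fixed list give distinct ranks even to equal errors. *)
Definition by_value : seq I := sort (fun x y => e y <= e x) (enum I).
Definition rank_of (j : I) : nat := index j by_value.
(** The default 0 prolongs the decreasing list, so windows of ranks may run past its end. *)
Definition value_at (m : nat) : R := nth 0 (map e by_value) m.

Lemma mem_by_value j : j \in by_value.
Proof. by rewrite mem_sort mem_enum. Qed.

Lemma size_by_value : size by_value = #|I|.
Proof. by rewrite size_sort cardE. Qed.

Lemma value_at_rank j : value_at (rank_of j) = e j.
Proof.
have jv := mem_by_value j.
by rewrite /value_at /rank_of (nth_map j) ?index_mem // nth_index.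
Qed.

Lemma rank_of_inj : injective rank_of.
Proof. by move=> i j; exact: index_inj (mem_by_value i) (mem_by_value j). Qed.

Lemma value_at_ge0 m : 0 <= value_at m.
Proof.
rewrite /value_at; have [lt|ge] := ltnP m (size (map e by_value)).
  by have /mapP[j _ ->] := mem_nth 0 lt.
by rewrite nth_default.
Qed.

Lemma value_at_mono m m' : (m <= m')%N -> value_at m' <= value_at m.
Proof.
move=> mm'; have [lt|ge] := ltnP m' (size (map e by_value)); last first.
  by rewrite {1}/value_at nth_default // value_at_ge0.
have st : sorted (fun x y : R => y <= x) (map e by_value).
  by rewrite sorted_map; apply: sort_sorted => x y; rewrite /= le_total.
have tr : transitive (fun x y : R => y <= x).
  by move=> y x z h1 h2; exact: le_trans h2 h1.
apply: (sorted_leq_nth tr (fun x => lexx x) 0 st) => //.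
by rewrite inE; exact: leq_ltn_trans mm' lt.
Qed.

Lemma sum_value_at : \sum_(m < #|I|) value_at m = \sum_j e j.
Proof.
rewrite -[RHS]big_enum /= -(perm_big _ (permEl (perm_sort (fun x y => e y <= e x) _))) /=.
rewrite -/by_value.
rewrite -[RHS](big_map e xpredT id) (big_nth 0) size_map size_by_value big_mkord.
by apply: eq_bigr.
Qed.

(** Remove the element of largest rank: the ranks in [J] are distinct and at least [h], so this one
    is at least [h + #|J| - 1] and is paid for by the last term. *)
Lemma sum_le_top_values (J : {set I}) h :
  (forall j, j \in J -> (h <= rank_of j)%N) ->
  \sum_(j in J) e j <= \sum_(m < #|J|) value_at (h + m).
Proof.
move: {2}#|J| (erefl #|J|) => N cJ; elim: N J cJ => [|N IH] J cJ hJ.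
  by rewrite (cards0_eq cJ) big_set0 cards0 big_ord0.
have [j0 j0J] : exists j0, j0 \in J by apply/set0Pn; rewrite -card_gt0 cJ.
have [j jJ' jmax] := arg_maxnP rank_of j0J; have jJ : j \in J := jJ'.
have cJj : #|J :\ j| = N by move: cJ; rewrite (cardsD1 j) jJ => -[].
rewrite (big_setD1 j) //= cJ big_ord_recr /= addrC lerD //.
  rewrite -cJj; apply: IH => // i; rewrite inE => /andP[_]; exact: hJ.
rewrite -value_at_rank; apply: value_at_mono.
have : (size [seq rank_of i | i <- enum J] <= size (iota h ((rank_of j).+1 - h)))%N.
  apply: uniq_leq_size; first by rewrite (map_inj_uniq rank_of_inj) enum_uniq.
  move=> m /mapP[i]; rewrite mem_enum => iJ ->; rewrite mem_iota.
  by have := hJ i iJ; have := jmax i iJ; rewrite /=; lia.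
by rewrite size_map -cardE size_iota cJ; have := hJ j jJ; lia.
Qed.

End SortedValues.

Lemma ln_leB1 (R : realType) (x : R) : 0 < x -> ln x <= x - 1.
Proof. by move=> x0; have := expR_ge1Dx (ln x); rewrite lnK ?posrE //; lra. Qed.

Section RoundPotential.
Variables (R : realType) (r : nat).
Hypothesis r_gt0 : (0 < r)%N.

(** Bounds the number of later rounds in which the entry of rank [m] can be
    charged, when [N] columns are left: [N] shrinks by a factor [7 / 8] in each
    round and is between [m / 2] and [12 * r * (m + 1)] when [m] is charged. *)
Definition charges (N m : nat) : R :=
  if (2 * N <= m)%N then 0
  else 1 + 8 * ln ((2 * minn N (12 * r * m.+1))%:R / m.+1%:R).

Let arg_ge1 N m : (m < 2 * N)%N ->
  1 <= (2 * minn N (12 * r * m.+1))%:R / m.+1%:R :> R.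
Proof.
by move=> mN; rewrite ler_pdivlMr ?ltr0n // mul1r ler_nat; move: r_gt0 mN; nia.
Qed.

Lemma charges_ge0 N m : 0 <= charges N m.
Proof.
rewrite /charges; case: leqP => // mN.
by rewrite addr_ge0 // mulr_ge0 // ln_ge0 // arg_ge1.
Qed.

Lemma charges_le N m : charges N m <= 1 + 8 * ln (24 * r)%:R.
Proof.
have r24 : 1 <= (24 * r)%:R :> R by rewrite ler1n muln_gt0.
rewrite /charges; case: leqP => mN.
  by rewrite addr_ge0 // mulr_ge0 // ln_ge0.
have a1 := arg_ge1 mN.
rewrite lerD2l ler_wpM2l // ler_ln ?posrE ?(lt_le_trans ltr01) //.
by rewrite ler_pdivrMr ?ltr0n // -natrM ler_nat; lia.
Qed.

(** If [m] is charged then [N < 12 * r * m.+1], so the minimum is [N], and shrinking by [7 / 8]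
    lowers the logarithm by at least [1 / 8]; the factor 8 turns this into one charge. The summand 1
    pays for the last charge, when [2 * N' <= m]. *)
Lemma charges_step N N' m : (8 * N' <= 7 * N)%N ->
  ((N %/ (12 * r) <= m < 2 * N)%N)%:R + charges N' m <= charges N m.
Proof.
move=> NN'; have := charges_ge0 N m; rewrite /charges.
have [mN|mN] := leqP (2 * N) m.
  rewrite ifT; last by move: NN' mN; lia.
  by rewrite andbF add0r.
have [mN'|mN'] := leqP (2 * N') m => g0.
  rewrite addr0 (@le_trans _ _ 1) ?lern1 ?leq_b1 //.
  by rewrite lerDl mulr_ge0 // ln_ge0 // arg_ge1.
have a1 := arg_ge1 mN; have a1' := arg_ge1 mN'.
have m0 : 0 < m.+1%:R :> R by rewrite ltr0n.
rewrite andbT; case: leqP => [h|h]; last first.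
  rewrite add0r lerD2l ler_wpM2l // ler_ln ?posrE ?(lt_le_trans ltr01) //.
  by rewrite ler_wpM2r ?invr_ge0 ?(ltW m0) // ler_nat; lia.
have Nlt : (N < 12 * r * m.+1)%N.
  by rewrite mulnC -ltn_divLR ?muln_gt0 // ltnS.
set x' := _ / _ in a1' *; rewrite (minn_idPl (ltnW Nlt)) in a1 *.
set x := _ / _ in a1 *.
have xx' : x' <= x * (7 / 8).
  rewrite /x' /x mulrAC ler_wpM2r ?invr_ge0 ?(ltW m0) // mulrA ler_pdivlMr //.
  by rewrite -!natrM ler_nat; move: NN'; lia.
have h1 : ln x' <= ln (x * (7 / 8)).
  by rewrite ler_ln ?posrE ?(lt_le_trans ltr01) // (le_trans a1').
have x_gt0 : 0 < x := lt_le_trans ltr01 a1.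
have c_gt0 : 0 < 7 / 8 :> R by rewrite divr_gt0.
have hM : ln (x * (7 / 8)) = ln x + ln (7 / 8) by apply: lnM; rewrite posrE.
rewrite hM in h1.
have h2 : ln (7 / 8 : R) <= 7 / 8 - 1 by apply: ln_leB1; lra.
rewrite /=; lra.
Qed.

End RoundPotential.

Local Open Scope classical_set_scope.
Local Open Scope ring_scope.

(** * Costs *)

Section PowerMeans.
Variable R : realType.
Implicit Types (a p theta : R).

(** With [b] the value of the tangent, use [ln x <= x - 1] at [a / b] and [1 / b]: with weights
    [theta] and [1 - theta] the right-hand sides cancel. *)
Lemma powR_le_tangent a theta : 0 <= a -> 0 < theta <= 1 ->
  a `^ theta <= theta * a + (1 - theta).
Proof.
move=> a0 /andP[t0 t1]; have [->|an0] := eqVneq a 0.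
  by rewrite powR0 ?gt_eqF // mulr0 add0r subr_ge0.
have {an0}a0 : 0 < a by rewrite lt_def an0.
set b := theta * a + (1 - theta).
have b0 : 0 < b by rewrite ltr_pwDl ?mulr_gt0 ?subr_ge0.
rewrite /powR gt_eqF // -[leRHS]lnK ?posrE // ler_expR.
have h1 := ln_leB1 (divr_gt0 a0 b0).
have h2 : ln b^-1 <= b^-1 - 1 by apply: ln_leB1; rewrite invr_gt0.
rewrite ln_div ?posrE // in h1; rewrite lnV ?posrE // in h2.
have : theta * (ln a - ln b) <= theta * (a / b - 1) by rewrite ler_wpM2l // ltW.
have : (1 - theta) * (- ln b) <= (1 - theta) * (b^-1 - 1).
  by rewrite ler_wpM2l // subr_ge0.
have : theta * (a / b - 1) + (1 - theta) * (b^-1 - 1) = 0.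
  have -> : theta * (a / b - 1) + (1 - theta) * (b^-1 - 1) = b / b - 1.
    by rewrite /b; field; rewrite gt_eqF.
  by rewrite divff ?subrr // gt_eqF.
lra.
Qed.

Lemma powR_half_sqr (y p : R) : (y ^+ 2) `^ (p / 2) = `|y| `^ p.
Proof.
by rewrite -real_normK ?num_real // -powR_mulrn // -powRrM mulrC mulfVK ?pnatr_eq0.
Qed.

(** The tangent bound is applied to each [y t ^+ 2] divided by the mean square [m]; these ratios
    average to 1. *)
Lemma sum_powR_le_sum_sqr (I : finType) (Q : {set I}) (y : I -> R) p :
  1 <= p < 2 ->
  \sum_(t in Q) `|y t| `^ p <=
  #|Q|%:R `^ (1 - p / 2) * (\sum_(t in Q) y t ^+ 2) `^ (p / 2).
Proof.
move=> /andP[p1 p2]; set s := \sum_(t in Q) y t ^+ 2.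
have h0 : 0 < p / 2 by lra.
have s0 : 0 <= s by apply: sumr_ge0 => t _; exact: sqr_ge0.
have [sz|sn] := eqVneq s 0.
  rewrite big1 ?mulr_ge0 ?powR_ge0 // => t tQ.
  have : y t ^+ 2 == 0.
    by move/eqP: sz; rewrite psumr_eq0 => [/allP/(_ t (mem_index_enum _))|i _];
      rewrite ?tQ // sqr_ge0.
  by rewrite sqrf_eq0 => /eqP ->; rewrite normr0 powR0 // gt_eqF; lra.
have {sn}s_gt0 : 0 < s by rewrite lt_def sn.
have Q0 : 0 < #|Q|%:R :> R.
  rewrite ltr0n lt0n; apply/negP => /eqP /cards0_eq Q0.
  by move: s_gt0; rewrite /s Q0 big_set0 ltxx.
pose m := s / #|Q|%:R; have m0 : 0 < m by rewrite divr_gt0.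
have key t : `|y t| `^ p <= m `^ (p / 2) * (p / 2 * (y t ^+ 2 / m) + (1 - p / 2)).
  rewrite -powR_half_sqr -{1}[y t ^+ 2](divfK (lt0r_neq0 m0)) [_ * m]mulrC.
  have y0 : 0 <= y t ^+ 2 / m by rewrite divr_ge0 ?sqr_ge0 // ltW.
  rewrite powRM ?(ltW m0) // ler_wpM2l ?powR_ge0 //.
  by apply: powR_le_tangent => //; lra.
apply: (le_trans (ler_sum _ (fun t _ => key t))).
rewrite -mulr_sumr big_split /= -mulr_sumr -mulr_suml -/s sumr_const.
have -> : s / m = #|Q|%:R by rewrite /m invf_div mulrC divfK // gt_eqF.
rewrite -[(1 - _) *+ _]mulr_natr -mulrDl addrC subrK mul1r.
rewrite /m powRM ?invr_ge0 ?(ltW Q0) // powRB; last by rewrite (gt_eqF Q0) implybT.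
have -> : #|Q|%:R^-1 `^ (p / 2) = (#|Q|%:R `^ (p / 2))^-1 :> R.
  by rewrite -[#|Q|%:R^-1]powR_inv1 ?(ltW Q0) // -powRrM mulN1r powRN.
rewrite powRr1 ?(ltW Q0) //; rewrite le_eqVlt; apply/orP; left.
by apply/eqP; ring.
Qed.

(** The ratios [w j ^+ 2 / s] sum to 1 and lie in [[0, 1]], where a power [p / 2 <= 1] only
    increases them. *)
Lemma powR_sum_sqr_le (I : finType) (Q : {set I}) (w : I -> R) p :
  1 <= p < 2 ->
  (\sum_(j in Q) w j ^+ 2) `^ (p / 2) <= \sum_(j in Q) `|w j| `^ p.
Proof.
move=> /andP[p1 p2]; set s := \sum_(t in Q) w t ^+ 2.
have s0 : 0 <= s by apply: sumr_ge0 => t _; exact: sqr_ge0.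
have [->|sn] := eqVneq s 0.
  rewrite powR0 ?gt_eqF //; last by lra.
  by apply: sumr_ge0 => j _; exact: powR_ge0.
have {sn}s_gt0 : 0 < s by rewrite lt_def sn.
have le j : j \in Q -> w j ^+ 2 <= s.
  move=> jQ; rewrite /s (bigD1 j) //= lerDl.
  by apply: sumr_ge0 => i _; exact: sqr_ge0.
have key j : j \in Q -> s `^ (p / 2) * (w j ^+ 2 / s) <= `|w j| `^ p.
  move=> jQ; rewrite -powR_half_sqr.
  rewrite -{2}[w j ^+ 2](divfK (lt0r_neq0 s_gt0)) [_ * s]mulrC.
  rewrite powRM ?divr_ge0 ?sqr_ge0 // ler_wpM2l ?powR_ge0 //.
  have [->|wn] := eqVneq (w j ^+ 2 / s) 0; first exact: powR_ge0.
  apply: ger1_powR; last by lra.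
  rewrite lt_def wn divr_ge0 ?sqr_ge0 //= ler_pdivrMr // mul1r; exact: le.
apply: le_trans (ler_sum _ key).
by rewrite -mulr_sumr -mulr_suml divff ?mulr1 // gt_eqF.
Qed.

Lemma normD_powR_le (a b p : R) : 1 <= p < 2 ->
  `|a - b| `^ p <= 4 * (`|a| `^ p + `|b| `^ p).
Proof.
move=> /andP[p1 p2]; pose m := Num.max `|a| `|b|.
have m0 : 0 <= m by rewrite le_max normr_ge0.
have le : `|a - b| <= 2 * m.
  apply: le_trans (ler_normB _ _) _; rewrite mulr_natl mulr2n lerD // le_max lexx //.
  by rewrite orbT.
have p0 : 0 <= p by lra.
apply: (@le_trans _ _ ((2 * m) `^ p)).
  by apply: ge0_ler_powR => //; rewrite nnegrE // mulr_ge0.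
rewrite powRM //; apply: ler_pM; rewrite ?powR_ge0 //.
  have -> : 4 = 2 `^ 2%:R :> R by rewrite powR_mulrn // expr2 -natrM.
  by apply: ler_powR; [rewrite ler1n|lra].
by rewrite /m maxEle; case: ifP => _; rewrite ?lerDl ?lerDr powR_ge0.
Qed.

End PowerMeans.

(** * Column costs against the errors of a low-rank matrix *)

Section CostBounds.
Variables (R : realType) (n d : nat) (p : R).
Hypothesis p_bounds : 1 <= p < 2.
Implicit Types (A B : 'M[R]_(n, d)) (S Q : {set 'I_d}).

Let p_gt0 : 0 < p. Proof. by case/andP: p_bounds => p1 _; lra. Qed.

Lemma pnorm_powR m (M : 'M[R]_(n, m)) :
  pnorm p M `^ p = \sum_i \sum_j `|M i j| `^ p.
Proof.
rewrite /pnorm -powRrM mulVf ?gt_eqF // powRr1 //.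
by apply: sumr_ge0 => i _; apply: sumr_ge0 => j _; exact: powR_ge0.
Qed.

Definition col_err A B (j : 'I_d) : R := \sum_i `|A i j - B i j| `^ p.

Lemma col_err_ge0 A B j : 0 <= col_err A B j.
Proof. by apply: sumr_ge0 => i _; exact: powR_ge0. Qed.

Lemma mulmx_colset A S (x : 'cV[R]_#|S|) i :
  (colset A S *m x) i 0 = \sum_a A i (enum_val a) * x a 0.
Proof. by rewrite mxE; apply: eq_bigr => a _; rewrite mxE. Qed.

Lemma cost_has_lbound A S t :
  has_lbound [set pnorm p (colset A S *m x - col t A) `^ p
             | x in [set: 'cV[R]_#|S|]].
Proof. by exists 0 => _ [x _ <-]; exact: powR_ge0. Qed.

Lemma cost_ge0 A S t : 0 <= cost A p S t.
Proof.
apply: lb_le_inf; first by exists (pnorm p (colset A S *m 0 - col t A) `^ p); exists 0.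
by move=> _ [x _ <-]; exact: powR_ge0.
Qed.

Lemma cost_le A S (x : 'I_d -> R) t :
  cost A p S t <= \sum_i `|\sum_(j in S) x j * A i j - A i t| `^ p.
Proof.
apply: ge_inf; first exact: cost_has_lbound.
exists (\col_a x (enum_val a)) => //.
rewrite pnorm_powR; apply: eq_bigr => i _; rewrite big_ord1 mxE mulmx_colset !mxE.
rewrite (big_enum_val (fun j => x j * A i j)) /=.
by congr (`|_ - _| `^ p); apply: eq_bigr => a _; rewrite mxE mulrC.
Qed.

Lemma sum_cost_half_subset A B (k r : nat) Q :
  (\rank B <= k)%N -> #|Q| = (2 * r).+1 -> (768 * k <= r)%N -> (0 < r)%N ->
  exists2 S : {set 'I_d}, S \subset Q /\ #|S| = r &
    \sum_(t in Q :\: S) cost A p (Q :\ t) t <=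
    100 * r%:R `^ (1 - p / 2) * \sum_(j in Q) col_err A B j.
Proof.
move=> rB cQ kr r0; have [p1 p2] := andP p_bounds.
have [S [X [SQ cS BX Xle]]] := column_interpolation rB cQ kr.
exists S => //; pose E i j := A i j - B i j.
have th : 0 <= 1 - p / 2 <= 1 by lra.
have r1 : 1 <= r%:R :> R by rewrite ler1n.
set rp := r%:R `^ (1 - p / 2).
have rp1 : 1 <= rp by rewrite -(powRr0 r%:R); apply: ler_powR => //; lra.
have Qr : #|Q|%:R `^ (1 - p / 2) <= 3 * rp.
  apply: (@le_trans _ _ ((3 * r%:R) `^ (1 - p / 2))).
    apply: ge0_ler_powR; rewrite ?nnegrE ?mulr_ge0 ?ler0n //; first by lra.
    by rewrite cQ -natrM ler_nat; lia.
  rewrite powRM ?ler0n // ler_wpM2r ?powR_ge0 //.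
  by apply: ler1_powR; [rewrite ler1n|lra].
(* [24 = 3 * 8]: the factor [3 * rp] comes from passing to l2 over [2 * r + 1] points, the 8 from
   the interpolation matrix. *)
have row i : \sum_(t in Q) `|\sum_(j in S) E i j * X j t| `^ p <=
             24 * rp * \sum_(j in Q) `|E i j| `^ p.
  apply: (le_trans (sum_powR_le_sum_sqr _ _ p_bounds)).
  have -> : 24 * rp * \sum_(j in Q) `|E i j| `^ p =
            (3 * rp) * (8 * \sum_(j in Q) `|E i j| `^ p) by ring.
  apply: ler_pM; rewrite ?powR_ge0 //.
  apply: (@le_trans _ _ ((8 * \sum_(j in S) E i j ^+ 2) `^ (p / 2))).
    apply: ge0_ler_powR => //; rewrite ?nnegrE; first by lra.
    - by apply: sumr_ge0 => t _; exact: sqr_ge0.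
    - by rewrite mulr_ge0 //; apply: sumr_ge0 => t _; exact: sqr_ge0.
  rewrite powRM //; last by apply: sumr_ge0 => t _; exact: sqr_ge0.
  apply: ler_pM; rewrite ?powR_ge0 //.
    by apply: ler1_powR; [rewrite ler1n|lra].
  apply: (le_trans (powR_sum_sqr_le _ _ p_bounds)).
  rewrite [leRHS](big_setID S) /= (finset.setIidPr SQ) lerDl.
  by apply: sumr_ge0 => t _; exact: powR_ge0.
(* Interpolation is exact on [B], so only [E] enters the residual; as [t] is outside [S], all of [S]
   is available in [Q :\ t]. *)
have costt t : t \in Q :\: S -> cost A p (Q :\ t) t <=
    \sum_i 4 * (`|\sum_(j in S) E i j * X j t| `^ p + `|E i t| `^ p).
  rewrite inE => /andP[tS tQ].
  apply: (le_trans (cost_le A (Q :\ t) (fun j => if j \in S then X j t else 0) t)).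
  apply: ler_sum => i _; apply: le_trans _ (normD_powR_le _ _ p_bounds).
  rewrite le_eqVlt; apply/orP; left; apply/eqP; congr (`| _ | `^ p).
  rewrite (bigID (mem S)) /= [X in _ + X - _]big1 ?addr0; last first.
    by move=> j /andP[_ /negbTE ->]; rewrite mul0r.
  have -> : \sum_(j in Q :\ t | j \in S) (if j \in S then X j t else 0) * A i j =
            \sum_(j in S) (E i j * X j t + X j t * B i j).
    apply: eq_big => [j|j /andP[_ ->]]; last by rewrite /E; ring.
    rewrite !inE; have [jS|] := boolP (j \in S); last by rewrite andbF.
    by rewrite (fintype.subsetP SQ) // !andbT; apply: contraNneq tS => <-.
  by rewrite big_split /= -BX // /E; ring.
apply: (le_trans (ler_sum _ costt)).
rewrite exchange_big [X in _ <= _ * X]exchange_big /= mulr_sumr; apply: ler_sum => i _.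
have sub (F : 'I_d -> R) : (forall t, 0 <= F t) ->
    \sum_(t in Q :\: S) F t <= \sum_(t in Q) F t.
  move=> F0; rewrite [leRHS](big_setID S) /= lerDr.
  by apply: sumr_ge0 => t _.
rewrite -mulr_sumr big_split /=.
have h1 := sub _ (fun t => powR_ge0 `|\sum_(j in S) E i j * X j t| p).
have h2 := sub _ (fun t => powR_ge0 `|E i t| p).
have h3 := row i.
set e := \sum_(j in Q) `|E i j| `^ p in h2 h3.
have e0 : 0 <= e by apply: sumr_ge0 => t _; exact: powR_ge0.
have h4 : e <= rp * e by rewrite ler_peMl.
apply: (@le_trans _ _ (4 * (24 * rp * e + rp * e))).
  by rewrite ler_wpM2l // lerD // ?(le_trans h1) // (le_trans h2).
rewrite -/e -/rp; lra.
Qed.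

End CostBounds.

(** Outside the common part [b] has no more elements than [G], and each costs at most any element of
    [G :\: b]. *)
Lemma sum_smallest_le (R : realFieldType) (I : finType) (c : I -> R)
    (U b G : {set I}) :
  (forall t, 0 <= c t) -> b \subset U -> G \subset U -> (#|b| <= #|G|)%N ->
  (forall t u, t \in b -> u \in U :\: b -> c t <= c u) ->
  \sum_(t in b) c t <= \sum_(t in G) c t.
Proof.
move=> c0 bU GU bG bmin; rewrite (big_setID G) [leRHS](big_setID b) /= finset.setIC lerD2l.
have card_le : (#|b :\: G| <= #|G :\: b|)%N.
  by rewrite !cardsD finset.setIC leq_sub2r.
have [->|/set0Pn[t0 t0b]] := eqVneq (b :\: G) finset.set0.
  by rewrite big_set0; apply: sumr_ge0.
have [t tb' tmax] := arg_maxP c t0b; have tb : t \in b :\: G := tb'.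
apply: (@le_trans _ _ (\sum_(u in b :\: G) c t)); first by apply: ler_sum => u /tmax.
rewrite sumr_const; apply: (@le_trans _ _ (c t *+ #|G :\: b|)).
  by rewrite ler_wpMn2l.
rewrite -sumr_const; apply: ler_sum => u; rewrite inE => /andP[ub uG].
apply: bmin; first by move: tb; rewrite inE => /andP[].
by rewrite inE ub (fintype.subsetP GU).
Qed.

Section Nceil.
Variable R : realType.
Implicit Type x : R.

Lemma nceilE x : 0 <= x -> (nceil x)%:R = (Num.ceil x)%:~R :> R.
Proof.
move=> x0; have c0 : 0 <= Num.ceil x by rewrite ceil_ge0 (lt_le_trans _ x0) // ltrN10.
by rewrite /nceil -[in RHS](gez0_abs c0).
Qed.

Lemma le_nceil x : 0 <= x -> x <= (nceil x)%:R.
Proof. by move=> x0; rewrite nceilE // ceil_ge. Qed.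

Lemma nceil_lt x : 0 <= x -> (nceil x)%:R < x + 1.
Proof. by move=> x0; rewrite nceilE // -ltrBlDr -[1]/(1%:~R) -intrB ceilB1_lt. Qed.

Lemma nceil_le x m : 0 <= x -> x <= m%:R -> (nceil x <= m)%N.
Proof.
by move=> x0 xm; rewrite -ltnS -(ltr_nat R) (lt_le_trans (nceil_lt x0)) // -natr1 lerD2r.
Qed.

End Nceil.

Section CostComparison.
Variables (R : realType) (n d : nat) (p : R).
Hypothesis p_bounds : 1 <= p < 2.
Implicit Types (A B : 'M[R]_(n, d)) (S Q : {set 'I_d}).

Let p_gt0 : 0 < p. Proof. by case/andP: p_bounds => p1 _; lra. Qed.

Lemma pnorm_powR_col m (M : 'M[R]_(n, m)) :
  pnorm p M `^ p = \sum_j \sum_i `|M i j| `^ p.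
Proof. by rewrite (pnorm_powR p_bounds) exchange_big. Qed.

Lemma cost_anti A S S' t : S' \subset S -> cost A p S t <= cost A p S' t.
Proof.
move=> sub; apply: lb_le_inf.
  by exists (pnorm p (colset A S' *m 0 - col t A) `^ p); exists 0.
move=> _ [x _ <-].
(* The coefficients on [S'], extended by zero. *)
pose y (j : 'I_d) := \sum_(a < #|S'|) (enum_val a == j)%:R * x a 0.
apply: le_trans (cost_le p_bounds A S y t) _.
rewrite pnorm_powR // le_eqVlt; apply/orP; left; apply/eqP; apply: eq_bigr => i _.
rewrite big_ord1 mxE mulmx_colset !mxE; congr (`|_ - _| `^ p).
under eq_bigr do rewrite mulr_suml.
rewrite exchange_big; apply: eq_bigr => a _ /=.
rewrite (bigD1 (enum_val a)) /=; last by rewrite (fintype.subsetP sub) // enum_valP.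
rewrite eqxx mul1r big1 ?addr0 1?mulrC // => j /andP[_ /negbTE ja].
by rewrite eq_sym ja !mul0r.
Qed.

Lemma cost_mem A S t : t \in S -> cost A p S t = 0.
Proof.
move=> tS; apply/eqP; rewrite eq_le cost_ge0 andbT.
apply: le_trans (cost_le p_bounds A S (fun j => (j == t)%:R) t) _.
rewrite big1 // => i _; rewrite (bigD1 t) //= eqxx mul1r big1 ?addr0.
  by rewrite subrr normr0 powR0 // gt_eqF.
by move=> j /andP[_ /negbTE ->]; rewrite mul0r.
Qed.

(** Replacing a single column of [V] cannot improve the fit, so each column is fitted optimally. *)
Lemma argmin_le_sum_cost A S (V : 'M[R]_(#|S|, d)) :
  is_argmin A p (colset A S) V ->
  pnorm p (colset A S *m V - A) `^ p <= \sum_t cost A p S t.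
Proof.
move=> minV; set U := colset A S.
rewrite pnorm_powR_col; apply: ler_sum => t _ /=.
apply: lb_le_inf.
  by exists (pnorm p (U *m 0 - col t A) `^ p); exists 0.
move=> _ [x _ <-].
pose V' : 'M[R]_(#|S|, d) := \matrix_(a, j) if j == t then x a 0 else V a j.
have le : pnorm p (U *m V - A) `^ p <= pnorm p (U *m V' - A) `^ p.
  by apply: ge0_ler_powR; rewrite ?nnegrE ?powR_ge0 ?(ltW p_gt0) //; exact: minV.
have V'E i j : (U *m V') i j = if j == t then (U *m x) i 0 else (U *m V) i j.
  case: (eqVneq j t) => [->|/negbTE jt]; rewrite [LHS]mxE [RHS]mxE;
    by apply: eq_bigr => a _; rewrite [V' _ _]mxE ?eqxx ?jt.
rewrite [leLHS](pnorm_powR_col (U *m V - A)) in le.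
rewrite [leRHS](pnorm_powR_col (U *m V' - A)) in le.
move: le.
rewrite (bigD1 t) //= [leRHS](bigD1 t) //=.
have -> : \sum_(j < d | j != t) \sum_(i < n) `|(U *m V' - A) i j| `^ p =
          \sum_(j < d | j != t) \sum_(i < n) `|(U *m V - A) i j| `^ p.
  apply: eq_bigr => j /negbTE jt; apply: eq_bigr => i _.
  by rewrite [in LHS]mxE V'E jt [in RHS]mxE.
rewrite lerD2r => le; apply: le_trans le _.
rewrite le_eqVlt; apply/orP; left; apply/eqP.
rewrite [RHS](pnorm_powR p_bounds); apply: eq_bigr => i _.
by rewrite big_ord1 [in LHS]mxE V'E eqxx [in RHS]mxE !mxE.
Qed.

End CostComparison.

(** * One round of sampling *)

Section Round.
Variables (R : realType) (n d k r : nat) (p : R) (A B : 'M[R]_(n, d)).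
Variable best : {set 'I_d} -> {set 'I_d} -> {set 'I_d}.
Hypotheses (p_bounds : 1 <= p < 2) (rB : (\rank B <= k)%N).
Hypotheses (k_le_r : (768 * k <= r)%N) (r_gt0 : (0 < r)%N).
Hypothesis bestP : best_rule A p 8^-1 best.
Implicit Types S T : {set 'I_d}.

Let e := col_err p A B.
Let e_ge0 j : 0 <= e j. Proof. exact: col_err_ge0. Qed.

(** The window consists of the ranks charged when [N] columns remain. Ranks refer to all [d]
    columns, so that the bounds of different rounds add entry by entry. *)
Definition round_bound (N : nat) : R :=
  1600 * r%:R `^ (1 - p / 2) *
  \sum_(m < d) value_at e m * (N %/ (12 * r) <= m < 2 * N)%N%:R.

(** The at most [N] columns of [T] outside [H] have ranks at least [h], so the values from rank [h]
    to [h + N - 1] bound their errors; [h <= N] keeps these ranks below [2 * N]. *)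
Lemma sum_light_le T (H := [set j in T | (rank_of e j < #|T| %/ (12 * r))%N]) :
  \sum_(j in T :\: H) e j <=
  \sum_(m < d) value_at e m * (#|T| %/ (12 * r) <= m < 2 * #|T|)%N%:R.
Proof.
set h := (_ %/ _)%N in H *; set N := #|T|.
have hN : (h <= N)%N by exact: leq_div.
apply: le_trans (sum_le_top_values e_ge0 (h := h) _) _.
  by move=> j; rewrite inE => /andP[+ jT]; rewrite /H inE jT /= -leqNgt.
have cle : (#|T :\: H| <= N)%N by rewrite subset_leq_card // subsetDl.
have v0 m : 0 <= value_at e m by exact: value_at_ge0.
have vd m : (d <= m)%N -> value_at e m = 0.
  by move=> dm; rewrite /value_at nth_default // size_map size_by_value card_ord.
apply: (@le_trans _ _ (\sum_(h <= m < h + N) value_at e m)).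
  rewrite -(big_mkord xpredT (fun m => value_at e (h + m))) /=.
  have -> : \sum_(h <= m < h + N) value_at e m = \sum_(0 <= m < N) value_at e (h + m).
    rewrite -{1}[h]add0n big_addn addKn.
    by apply: eq_bigr => m _; rewrite addnC.
  rewrite [leRHS](@big_cat_nat _ _ _ #|T :\: H|) //= lerDl.
  by apply: sumr_ge0 => m _; exact: v0.
rewrite -(big_mkord xpredT (fun m => value_at e m * (h <= m < 2 * N)%N%:R)).
apply: (@le_trans _ _ (\sum_(0 <= m < d + (h + N)) value_at e m * (h <= m < 2 * N)%N%:R)).
  rewrite [leRHS](@big_cat_nat _ _ _ h) /=; [|by []|by lia].
  apply: ler_wpDl.
    by apply: sumr_ge0 => m _; rewrite mulr_ge0.
  rewrite [leRHS](@big_cat_nat _ _ _ (h + N)%N) /=; [|by lia|by lia].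
  apply: ler_wpDr; first by apply: sumr_ge0 => m _; rewrite mulr_ge0.
  rewrite !big_nat; apply: ler_sum => m /andP[hm mN].
  by rewrite hm (leq_trans mN) ?mulr1 //; lia.
rewrite (@big_cat_nat _ _ _ d) //= ?leq_addr // gerDl.
rewrite big_nat big1 // => m /andP[dm _]; by rewrite vd ?mul0r.
Qed.

(** Counting yields a cheap [G] with at least an eighth of the columns outside [S]; [best T S] has
    no more elements than [G] and consists of cheapest ones. *)
Lemma many_good_draws T : (2 * r < #|T|)%N ->
  (#|subsets_of_size (2 * r) T| <=
   16 * #|[set S in subsets_of_size (2 * r) T |
           (total_cost A p best T S <= round_bound #|T|)%R]|)%N.
Proof.
move=> Tgt; set H := [set j in T | (rank_of e j < #|T| %/ (12 * r))%N].
pose D : R := 100 * r%:R `^ (1 - p / 2).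
have D0 : 0 <= D by rewrite mulr_ge0 // powR_ge0.
have cH : (12 * r * #|H| <= #|T|)%N.
  apply: (@leq_trans (12 * r * (#|T| %/ (12 * r)))); last by rewrite mulnC leq_trunc_div.
  rewrite leq_mul2l; apply/orP; right.
  have : (size [seq rank_of e j | j <- enum H] <= size (iota 0 (#|T| %/ (12 * r))))%N.
    apply: uniq_leq_size; first by rewrite (map_inj_uniq (@rank_of_inj _ _ e)) enum_uniq.
    by move=> m /mapP[j]; rewrite mem_enum inE => /andP[_ jh] ->; rewrite mem_iota.
  by rewrite size_map -cardE size_iota.
have half (Q : {set 'I_d}) : Q \subset T -> #|Q| = (2 * r).+1 ->
    exists2 S : {set 'I_d}, S \subset Q /\ #|S| = r &
    \sum_(t in Q :\: S) cost A p (Q :\ t) t <= D * \sum_(j in Q) e j.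
  by move=> _ cQ; exact: sum_cost_half_subset rB cQ k_le_r r_gt0.
apply: leq_trans (many_cheap_subsets (fun S t => cost_ge0 p A S t)
  e_ge0 D0 r_gt0 Tgt cH half) _.
rewrite leq_mul2l /=; apply: subset_leq_card; apply/fintype.subsetP => S.
rewrite !inE => /andP[-> /existsP[G /and3P[GU cG costG]]] /=.
have [bU cb bmin] := bestP T S.
have bG : (#|best T S| <= #|G|)%N.
  rewrite cb; apply: nceil_le; first by rewrite mulr_ge0 ?invr_ge0.
  by rewrite ler_pdivrMl // -natrM ler_nat.
apply: le_trans (sum_smallest_le (fun t => cost_ge0 p A S t) bU GU bG bmin) _.
apply: le_trans costG _.
have -> : 16 * D = 1600 * r%:R `^ (1 - p / 2) by rewrite /D; ring.
rewrite /round_bound; apply: ler_wpM2l; last exact: sum_light_le.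
exact: mulr_ge0 (ler0n _ _) (powR_ge0 _ _).
Qed.

End Round.

(** * The sampling procedure *)

Section Probability.
Variable R : realType.
Implicit Types X Y : finType.

Lemma Pr_ge0 X (mu : {ffun X -> R}) (E : X -> Prop) :
  (forall x, 0 <= mu x) -> 0 <= Pr mu E.
Proof. by move=> mu0; apply: sumr_ge0. Qed.

Lemma Pr_mono X (mu : {ffun X -> R}) (E F : X -> Prop) :
  (forall x, 0 <= mu x) -> (forall x, E x -> F x) -> Pr mu E <= Pr mu F.
Proof.
move=> mu0 EF; rewrite /Pr big_mkcond [leRHS]big_mkcond /=.
apply: ler_sum => x _; case: asboolP => [/EF Fx|_]; first by rewrite asboolT.
by case: ifP.
Qed.

Lemma Pr_dbind X Y (mu : {ffun X -> R}) (f : X -> {ffun Y -> R}) E :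
  Pr (dbind mu f) E = \sum_x mu x * Pr (f x) E.
Proof.
rewrite /Pr; under eq_bigr do rewrite ffunE.
by rewrite exchange_big; apply: eq_bigr => x _; rewrite mulr_sumr.
Qed.

Lemma Pr_dret X (x : X) (E : X -> Prop) : E x -> Pr (dret x : {ffun X -> R}) E = 1.
Proof.
move=> Ex; rewrite /Pr (bigD1 x) /=; last exact/asboolP.
rewrite ffunE eqxx big1 ?addr0 // => y /andP[_ /negbTE yx].
by rewrite ffunE yx.
Qed.

Lemma dret_ge0 X (x y : X) : 0 <= (dret x : {ffun X -> R}) y.
Proof. by rewrite ffunE. Qed.

Lemma dunif_ge0 X (E : {set X}) x : 0 <= (dunif E : {ffun X -> R}) x.
Proof. by rewrite ffunE divr_ge0. Qed.

Lemma dbind_ge0 X Y (mu : {ffun X -> R}) (f : X -> {ffun Y -> R}) y :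
  (forall x, 0 <= mu x) -> (forall x y, 0 <= f x y) -> 0 <= dbind mu f y.
Proof. by move=> mu0 f0; rewrite ffunE; apply: sumr_ge0 => x _; rewrite mulr_ge0. Qed.

(** Union bound: [a] for a bad draw, [b] for a failure after a good one. *)
Lemma Pr_dbind_dunif X Y (E bad : {set X}) (f : X -> {ffun Y -> R}) F (a b : R) :
  (0 < #|E|)%N -> bad \subset E -> #|bad|%:R <= a * #|E|%:R -> 0 <= b ->
  (forall x, x \in E :\: bad -> 1 - b <= Pr (f x) F) ->
  (forall x y, 0 <= f x y) ->
  1 - (a + b) <= Pr (dbind (dunif E) f) F.
Proof.
move=> E0 badE bad_le b0 good f0; rewrite Pr_dbind.
have E0' : 0 < #|E|%:R :> R by rewrite ltr0n.
have c : #|E :\: bad|%:R = #|E|%:R - #|bad|%:R :> R.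
  by rewrite cardsD (finset.setIidPr badE) natrB // subset_leq_card.
apply: (@le_trans _ _ (\sum_(x in E :\: bad) #|E|%:R^-1 * (1 - b))).
  rewrite sumr_const -[(_ * _) *+ _]mulr_natl mulrCA -ler_pdivrMl ?invr_gt0 // invrK.
  have : 0 <= b * #|bad|%:R by rewrite mulr_ge0.
  by rewrite c; lra.
rewrite big_mkcond; apply: ler_sum => x _ /=; case: ifP => [xg|_]; last first.
  by rewrite mulr_ge0 ?dunif_ge0 ?Pr_ge0.
have xE : x \in E by move: xg; rewrite inE => /andP[].
rewrite ffunE xE mul1r ler_wpM2l ?invr_ge0 ?ler0n //; exact: good.
Qed.

Lemma card_draws d q s (T : {set 'I_d}) (X : {set {set 'I_d}}) :
  #|[set D in draws q s T | [forall j, D j \in X]]| = (#|X :&: subsets_of_size s T| ^ q)%N.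
Proof.
have := card_ffun_on 'I_q (mem (X :&: subsets_of_size s T)).
rewrite card_ord => <-; apply: eq_card => D.
rewrite !inE; apply/andP/ffun_onP => [[/forallP h /forallP h'] j|h].
  by have := h j; have := h' j; rewrite !inE => -> ->.
by split; apply/forallP => j; have := h j; rewrite !inE => /andP[].
Qed.

Lemma card_draws_all d q s (T : {set 'I_d}) :
  #|draws q s T| = (#|subsets_of_size s T| ^ q)%N.
Proof.
have := @card_draws d q s T finset.setT; rewrite finset.setTI => <-.
by apply: eq_card => D; rewrite !inE; case: [forall j, _] => //=;
  symmetry; apply/forallP => j; rewrite inE.
Qed.

(** Each of the [q] independent draws misses [good] with probability at most
    [15 / 16 <= expR (- 16^-1)]. *)
Lemma card_bad_draws d q s (T : {set 'I_d}) (good : {set {set 'I_d}}) :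
  good \subset subsets_of_size s T ->
  (#|subsets_of_size s T| <= 16 * #|good|)%N ->
  #|[set D in draws q s T | [forall j, D j \notin good]]|%:R <=
  expR (- (q%:R / 16)) * #|draws q s T|%:R :> R.
Proof.
move=> gs g16; have -> : #|[set D in draws q s T | [forall j, D j \notin good]]| =
    (#|subsets_of_size s T :\: good| ^ q)%N.
  rewrite finset.setDE finset.setIC -card_draws; apply: eq_card => D; rewrite !inE.
  by congr (_ && _); apply: eq_forallb => j; rewrite inE.
rewrite card_draws_all !natrX.
have -> : expR (- (q%:R / 16)) = expR (- 16^-1) ^+ q :> R.
  by rewrite -expRM_natl; congr expR; ring.
rewrite -exprMn; apply: lerXn2r; rewrite ?nnegrE ?mulr_ge0 ?expR_ge0 //.
apply: (@le_trans _ _ ((1 - 16^-1) * #|subsets_of_size s T|%:R)); last first.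
  by rewrite ler_wpM2r // expR_ge1Dx.
rewrite cardsD (finset.setIidPr gs) natrB ?subset_leq_card //.
have : (#|subsets_of_size s T|%:R : R) <= (16 * #|good|)%:R by rewrite ler_nat.
by rewrite natrM; lra.
Qed.

Lemma sampling_rounds_ge0 d q r (best : {set 'I_d} -> {set 'I_d} -> {set 'I_d})
    (pick : {set 'I_d} -> {ffun 'I_q -> {set 'I_d}} -> 'I_q) m (T S0 S : {set 'I_d}) :
  0 <= sampling_rounds R r best pick m T S0 S.
Proof.
elim: m T S0 S => [|m IH] T S0 S /=; first exact: dret_ge0.
case: ifP => _; first exact: dret_ge0.
by apply: dbind_ge0 => [D|D S']; [exact: dunif_ge0 | exact: IH].
Qed.

Lemma sampling_rounds_card d q r (best : {set 'I_d} -> {set 'I_d} -> {set 'I_d})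
    (pick : {set 'I_d} -> {ffun 'I_q -> {set 'I_d}} -> 'I_q) m (T S0 S : {set 'I_d}) :
  (#|S0| + m * (2 * r) < #|S|)%N -> sampling_rounds R r best pick m T S0 S = 0.
Proof.
elim: m T S0 => [|m IH] T S0 /= lt.
  rewrite ffunE; case: eqP => // E; move: lt; rewrite E mul0n addn0 ltnn //.
case: ifP => T2.
  rewrite ffunE; case: eqP => // E; move: lt; rewrite E.
  rewrite ltnNge => /negP[]; apply: leq_trans (leq_card_setU S0 T).1 _.
  by rewrite leq_add2l (leq_trans T2) // (mulSn m) leq_addr.
rewrite ffunE big1 // => D _; rewrite ffunE.
have [|_] := boolP (D \in _); last by rewrite !mul0r.
rewrite inE => /forallP /(_ (pick T D)) /andP[_ /eqP cD].
rewrite IH ?mulr0 //; apply: leq_ltn_trans lt.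
by rewrite (mulSn m) addnA leq_add2r -cD (leq_card_setU _ _).1.
Qed.

End Probability.

(** * All rounds together *)

Section Success.
Variables (R : realType) (n d k r q : nat) (p : R) (A B : 'M[R]_(n, d)).
Variable best : {set 'I_d} -> {set 'I_d} -> {set 'I_d}.
Variable pick : {set 'I_d} -> {ffun 'I_q -> {set 'I_d}} -> 'I_q.
Hypotheses (p_bounds : 1 <= p < 2) (rB : (\rank B <= k)%N).
Hypotheses (k_le_r : (768 * k <= r)%N) (r_gt0 : (0 < r)%N).
Hypotheses (bestP : best_rule A p 8^-1 best) (pickP : pick_rule A p best pick).
Implicit Types S T : {set 'I_d}.

Let e := col_err p A B.
Let e_ge0 j : 0 <= e j. Proof. exact: col_err_ge0. Qed.

Definition total_bound (N : nat) : R :=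
  1600 * r%:R `^ (1 - p / 2) * \sum_(m < d) value_at e m * charges R r N m.

Let D_ge0 : 0 <= 1600 * r%:R `^ (1 - p / 2) :> R.
Proof. exact: mulr_ge0 (ler0n _ _) (powR_ge0 _ _). Qed.

Lemma total_bound_ge0 N : 0 <= total_bound N.
Proof.
apply: mulr_ge0 => //; apply: sumr_ge0 => m _.
by apply: mulr_ge0; [exact: value_at_ge0 | exact: charges_ge0].
Qed.

Lemma total_bound_step N N' : (8 * N' <= 7 * N)%N ->
  round_bound r p A B N + total_bound N' <= total_bound N.
Proof.
move=> NN'; rewrite /round_bound /total_bound -mulrDr; apply: ler_wpM2l => //.
rewrite -big_split; apply: ler_sum => m _ /=; rewrite -mulrDr.
by apply: ler_wpM2l; [exact: value_at_ge0 | exact: charges_step].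
Qed.

(** Costs are taken against the final output [S]; as costs only drop when the set grows, the bounds
    of successive rounds add up. *)
Definition success T S0 S : Prop :=
  S0 \subset S /\ \sum_(t in T) cost A p S t <= total_bound #|T|.

Lemma card_next T S : (8 * #|T :\: (S :|: best T S)| <= 7 * #|T|)%N.
Proof.
have [bU cb _] := bestP T S.
have h : (#|T :\: S| <= 8 * #|best T S|)%N.
  rewrite -(ler_nat R) natrM -ler_pdivrMl // cb.
  by apply: le_nceil; rewrite mulr_ge0 ?invr_ge0.
have -> : T :\: (S :|: best T S) = (T :\: S) :\: best T S by rewrite finset.setDDl.
rewrite cardsD (finset.setIidPr bU).
have h1 : (#|T :\: S| <= #|T|)%N by rewrite subset_leq_card // subsetDl.
by lia.
Qed.

(** [T] splits into [S'], of cost zero, [best T S'], whose costs only drop from [S'] to [S], and the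
    columns left to later rounds. *)
Lemma success_step T S0 S' S : S' \subset T ->
  total_cost A p best T S' <= round_bound r p A B #|T| ->
  success (T :\: (S' :|: best T S')) (S0 :|: S') S -> success T S0 S.
Proof.
move=> S'T cS' [sub le]; move: sub; rewrite finset.subUset => /andP[sub0 sub'].
split=> //; apply: le_trans (total_bound_step (card_next T S')).
have [bU _ _] := bestP T S'.
rewrite (big_setID (S' :|: best T S')) /=; apply: lerD => //.
apply: le_trans cS'; rewrite /total_cost.
rewrite big_mkcond [leRHS]big_mkcond /=; apply: ler_sum => t _.
rewrite !inE; have [tS'|_] := boolP (t \in S').
  rewrite (cost_mem p_bounds) ?(fintype.subsetP sub') //.
  by do 2 case: ifP => // _; exact: cost_ge0.
case: (t \in T) => /=; last by case: ifP => // _; exact: cost_ge0.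
by case: ifP => // _; exact: (cost_anti p_bounds).
Qed.

(** A round leaves at most [7 / 8] of the columns, so the hypothesis makes [m] rounds exhaust [T].
    Each round adds to the failure probability the chance that no repetition is good. *)
Lemma sampling_success m T S0 : (#|T| * 7 ^ m < 8 ^ m)%N ->
  1 - m%:R * expR (- (q%:R / 16)) <=
  Pr (sampling_rounds R r best pick m T S0) (success T S0).
Proof.
elim: m T S0 => [|m IH] T S0 Tm.
  have T0 : T = finset.set0 by apply: cards0_eq; move: Tm; rewrite !expn0; lia.
  rewrite mul0r subr0 /= Pr_dret //; split=> //.
  by rewrite T0 big_set0 total_bound_ge0.
have b0 : 0 <= m%:R * expR (- (q%:R / 16)) :> R by rewrite mulr_ge0 ?expR_ge0.
rewrite -[m.+1%:R]natr1 mulrDl mul1r [_ + expR _]addrC /=; case: ifP => [_|/negbT].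
  rewrite Pr_dret; first by rewrite gerBl addr_ge0 ?expR_ge0.
  split; first exact: finset.subsetUl.
  rewrite big1 ?total_bound_ge0 // => t tT.
  by rewrite (cost_mem p_bounds) // inE tT orbT.
rewrite -ltnNge => T2.
set good := [set S in subsets_of_size (2 * r) T |
  (total_cost A p best T S <= round_bound r p A B #|T|)%R].
have gsub : good \subset subsets_of_size (2 * r) T.
  by apply/fintype.subsetP => S; rewrite inE => /andP[].
have many : (#|subsets_of_size (2 * r) T| <= 16 * #|good|)%N.
  exact: (many_good_draws p_bounds rB k_le_r r_gt0 bestP T2).
apply: (Pr_dbind_dunif (bad := [set D in draws q (2 * r) T | [forall j, D j \notin good]])).
- rewrite card_draws_all expn_gt0; apply/orP; left.
  by rewrite /subsets_of_size cards_draws bin_gt0 ltnW.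
- by apply/fintype.subsetP => D; rewrite inE => /andP[].
- exact: card_bad_draws.
- exact: b0.
- move=> D; rewrite inE inE => /andP[+ Dd]; rewrite Dd /= negb_forall => /existsP[j].
  rewrite negbK inE => /andP[_ cj].
  have DT j' : D j' \subset T by move: Dd; rewrite inE => /forallP/(_ j')/andP[].
  set S' := D (pick T D).
  have cS' : total_cost A p best T S' <= round_bound r p A B #|T|.
    exact: le_trans (pickP T D j) cj.
  apply: le_trans (IH (T :\: (S' :|: best T S')) (S0 :|: S') _) _.
    rewrite -(ltn_pmul2l (isT : 0 < 8)%N) -expnS; apply: leq_ltn_trans Tm.
    have h := card_next T S'.
    by rewrite expnS !mulnA leq_mul2r [(_ * 7)%N]mulnC h orbT.
  apply: Pr_mono => [S|S]; first exact: sampling_rounds_ge0.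
  by apply: success_step => //; exact: DT.
- by move=> D S; exact: sampling_rounds_ge0.
Qed.

End Success.

(** * Sizes of the parameters *)

Section Constants.
Variable R : realType.

Lemma log1_ge1 (x : R) : 1 <= log1 x.
Proof. by rewrite /log1 le_max lexx. Qed.

Lemma ln_le_log1 (x : R) : ln x <= log1 x.
Proof. by rewrite /log1 le_max lexx orbT. Qed.

Lemma log1_le (x : R) : 1 <= x -> log1 x <= x.
Proof.
by move=> x1; rewrite /log1 ge_max x1 /=; have := @ln_leB1 R x; lra.
Qed.

Let logs (p : R) (k : nat) : R := log1 k%:R * (if p == 1 then 1 else log1 (log1 k%:R) ^+ 2).

Let logs_ge1 p k : 1 <= logs p k.
Proof.
apply: mulr_ege1; first exact: log1_ge1.
by case: ifP => // _; rewrite exprn_ege1 // log1_ge1.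
Qed.

Lemma sample_rank_ge (p : R) k : (768 * k <= sample_rank 768%:R p k)%N.
Proof.
have h0 : 0 <= 768%:R * k%:R :> R by exact: mulr_ge0 (ler0n _ _) (ler0n _ _).
rewrite -(ler_nat R) /sample_rank -[_ * _ * log1 _ * _]mulrA -/(logs p k) natrM.
have h1 := logs_ge1 p k; have := ler_peMr h0 h1.
move=> h; apply: le_trans (le_nceil _); first exact: h.
exact: le_trans h0 h.
Qed.

(** From [r <= 769 * k ^ 4]: crudely [ln 24 <= 24] and [ln 769 <= 769], while [ln (k ^ 4)] gives the
    4. *)
Definition log_const : R := 1 + 8 * (24 + 769 + 4).

Lemma ln_sample_rank_le (p : R) k : (0 < k)%N ->
  1 + 8 * ln (24 * sample_rank 768%:R p k)%:R <= log_const * log1 k%:R.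
Proof.
move=> k0; set r := sample_rank _ _ _.
have k1 : 1 <= k%:R :> R by rewrite ler1n.
have k0' : 0 < k%:R :> R by rewrite ltr0n.
have c0 : 0 <= 768%:R :> R by rewrite ler0n.
have L1 := log1_ge1 (k%:R : R); have Lk := log1_le k1; have lnL := ln_le_log1 (k%:R : R).
set L := log1 _ in L1 Lk lnL *.
have l1 : logs p k <= k%:R ^+ 3.
  rewrite exprS; apply: ler_pM => //; first by rewrite (le_trans _ L1).
    by case: ifP => // _; rewrite sqr_ge0.
  case: ifP => _; first by rewrite exprn_ege1.
  apply: lerXn2r; rewrite ?nnegrE ?(le_trans ler01 (log1_ge1 _)) ?(ltW k0') //.
  exact: le_trans (log1_le L1) Lk.
have rle : r%:R <= 769%:R * k%:R ^+ 4 :> R.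
  have x0 : 0 <= 768%:R * k%:R * log1 k%:R * (if p == 1 then 1 else log1 (log1 k%:R) ^+ 2) :> R.
    rewrite -mulrA -/(logs p k); apply: mulr_ge0 (le_trans ler01 (logs_ge1 p k)).
    exact: mulr_ge0 c0 (ltW k0').
  apply: le_trans (ltW (nceil_lt x0)) _.
  have h1 : 1 <= k%:R ^+ 4 :> R by rewrite exprn_ege1.
  have h2 : 768%:R * k%:R * logs p k <= 768%:R * k%:R ^+ 4.
    by rewrite -mulrA [k%:R ^+ 4]exprS !ler_wpM2l // ltW.
  by move: h2; rewrite /logs mulrA; lra.
have r0 : 0 < r%:R :> R.
  by rewrite ltr0n; apply: leq_trans (sample_rank_ge p k); rewrite muln_gt0 k0.
have c24 : 0 < 24 :> R by rewrite ltr0n.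
have c769 : 0 < 769%:R :> R by rewrite ltr0n.
have k4 : 0 < k%:R ^+ 4 :> R by rewrite exprn_gt0.
have lr : ln (24 * r)%:R <= 24 + 769 + 4 * L.
  rewrite natrM lnM ?posrE //.
  have : ln r%:R <= ln (769%:R * k%:R ^+ 4) :> R by rewrite ler_ln ?posrE ?mulr_gt0.
  rewrite lnM ?posrE // lnXn // => h.
  have := ln_leB1 c24; have := ln_leB1 c769; move: h; rewrite -mulr_natl; lra.
by rewrite /log_const; lra.
Qed.

End Constants.

(** Avoids proving that the infimum is attained: since the sampling procedure has
    finitely many outcomes, one approximation [B], fixed before sampling, serves
    them all. *)
Lemma opt_rank_approx (R : realType) (n d k : nat) (A : 'M[R]_(n, d)) (p K : R)
    (X : finType) (x0 : X) (cost_of : X -> R -> Prop) :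
  0 < K ->
  exists2 B : 'M[R]_(n, d), (\rank B <= k)%N &
    forall x, (forall v, cost_of x v -> v <= K * pnorm p (A - B)) ->
              (forall v, cost_of x v -> v <= K * opt_rank A p k).
Proof.
move=> K0.
(* If some [v] violates the conclusion at [x], take [B] with error below [v / K]: the premise then
   fails for every [b] up to that error. *)
have /boolp.choice [f fP] : forall x, exists B : 'M[R]_(n, d), (\rank B <= k)%N /\
    forall b, b <= pnorm p (A - B) -> (forall v, cost_of x v -> v <= K * b) ->
     (forall v, cost_of x v -> v <= K * opt_rank A p k).
  move=> x.
  have [h|/existsNP[v /not_implyP[xv /negP]]] :=
      pselect (forall v, cost_of x v -> v <= K * opt_rank A p k).
    by exists 0; rewrite mxrank0.
  rewrite -ltNge mulrC -ltr_pdivlMr // => vK.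
  have [|_ [B rB <-] BK] := inf_lt _ vK.
    by exists (pnorm p (A - 0)); exists 0 => //=; rewrite mxrank0.
  exists B; split=> // b bB /(_ v xv) vb; exfalso.
  by move: BK; rewrite ltr_pdivlMr // mulrC ltNge (le_trans vb) // ler_wpM2l // ltW.
have [y _ ymin] := @arg_minP _ _ _ x0 xpredT (fun x => pnorm p (A - f x)) isT.
exists (f y); first by case: (fP y).
by move=> x; have [_] := fP x; apply; exact: ymin.
Qed.

(** * Approximation factor and failure probability *)

Section Guarantee.
Variable R : realType.

Definition approx_const : R := 1600 * log_const R.

(** Take [p]-th roots: [(1 - p / 2) / p = p^-1 - 2^-1], and the root of [c >= 1] is at most [c]. *)
Lemma powR_root_le (x c r L e p : R) : 1 <= p ->
  0 <= x -> 1 <= c -> 0 <= r -> 0 <= L -> 0 <= e ->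
  x `^ p <= c * (r `^ (1 - p / 2) * L) * e `^ p ->
  x <= c * (r `^ (p^-1 - 2^-1) * L `^ p^-1) * e.
Proof.
move=> p1 x0 c1 r0 L0 e0 le; have p0 : 0 < p by lra.
have c0 : 0 <= c by lra.
have pinv y : 0 <= y -> (y `^ p) `^ p^-1 = y.
  by move=> y0; rewrite -powRrM mulfV ?gt_eqF // powRr1.
have rL0 : 0 <= r `^ (1 - p / 2) * L by rewrite mulr_ge0 ?powR_ge0.
have crL0 : 0 <= c * (r `^ (1 - p / 2) * L) by rewrite mulr_ge0.
have : (x `^ p) `^ p^-1 <= (c * (r `^ (1 - p / 2) * L) * e `^ p) `^ p^-1.
  apply: ge0_ler_powR => //; rewrite ?nnegrE ?powR_ge0 ?invr_ge0 ?(ltW p0) //.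
  by rewrite mulr_ge0 ?powR_ge0.
rewrite pinv // powRM ?powR_ge0 // pinv // powRM // powRM ?powR_ge0 // -powRrM.
have -> : (1 - p / 2) / p = p^-1 - 2^-1.
  by rewrite mulrBl mul1r mulrAC mulfV ?gt_eqF // mul1r.
move/le_trans; apply; apply: ler_wpM2r => //; apply: ler_wpM2r.
  by rewrite mulr_ge0 ?powR_ge0.
by apply: ler1_powR => //; rewrite invf_le1.
Qed.

(** A uniform bound on the charges by a multiple of [log1 k] leaves the sum of all column errors,
    which is the [p]-th power of the norm of [A - B]. *)
Lemma success_bound (n d k : nat) (p : R) (A B : 'M[R]_(n, d)) (S : {set 'I_d})
    (V : 'M[R]_(#|S|, d)) (r := sample_rank (768%:R : R) p k) :
  (0 < k)%N -> 1 <= p < 2 -> success r p A B (finset.setTfor 'I_d) finset.set0 S ->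
  is_argmin A p (colset A S) V ->
  pnorm p (colset A S *m V - A) <=
  approx_const * (r%:R `^ (p^-1 - 2^-1) * log1 k%:R `^ p^-1) * pnorm p (A - B).
Proof.
move=> k0 pb [_ le] minV; have [p1 p2] := andP pb.
have p0 : 0 < p by lra.
have r0 : (0 < r)%N.
  by apply: leq_trans (sample_rank_ge p k); rewrite muln_gt0 k0.
have r0' : 0 <= r%:R :> R by rewrite ler0n.
have L1 := log1_ge1 (k%:R : R); set L := log1 _ in L1 *.
set e := pnorm p (A - B).
have e0 : 0 <= e by exact: powR_ge0.
have lc1 : 1 <= log_const R by rewrite /log_const; lra.
have C1 : 1 <= approx_const.
  by apply: mulr_ege1 => //; rewrite ler1n.
have C0 : 0 <= approx_const by exact: le_trans C1.
have eE : \sum_j col_err p A B j = e `^ p.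
  rewrite /e (pnorm_powR_col pb); apply: eq_bigr => j _; apply: eq_bigr => i _.
  by rewrite !mxE.
have W0 : 0 <= r%:R `^ (1 - p / 2) :> R by exact: powR_ge0.
have main : pnorm p (colset A S *m V - A) `^ p <=
    approx_const * (r%:R `^ (1 - p / 2) * L) * e `^ p.
  apply: le_trans (argmin_le_sum_cost pb minV) _.
  have -> : \sum_t cost A p S t = \sum_(t in finset.setTfor 'I_d) cost A p S t.
    by apply: eq_bigl => t; rewrite inE.
  apply: le_trans le _; rewrite /total_bound.
  have -> : approx_const * (r%:R `^ (1 - p / 2) * L) * e `^ p =
    1600 * r%:R `^ (1 - p / 2) * (log_const R * L * e `^ p).
    by rewrite /approx_const; ring.
  apply: ler_wpM2l; first exact: mulr_ge0 (ler0n _ _) W0.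
  rewrite -eE -(sum_value_at (col_err p A B)) card_ord mulr_sumr.
  apply: ler_sum => m _; rewrite mulrC; apply: ler_wpM2r.
    by apply: value_at_ge0 => j; exact: col_err_ge0.
  exact: le_trans (charges_le R r0 _ _) (ln_sample_rank_le p k0).
exact: (powR_root_le p1 (powR_ge0 _ _) C1 r0' (le_trans ler01 L1) e0 main).
Qed.

(** At most [17 * L] rounds fail with probability at most [expR (- (2 * L))] each;
    [L * expR (- L) <= 1] and [expR (- L) * d.+1%:R <= 2] give [34 = 17 * 2]. *)
Lemma failure_le d (L := log1 (d%:R : R)) :
  (nceil (16 * L))%:R * expR (- ((nceil (32 * L))%:R / 16)) <= 34 * d.+1%:R^-1 :> R.
Proof.
have L1 : 1 <= L by exact: log1_ge1.
have h16 : 0 <= 16 * L by lra.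
have h32 : 0 <= 32 * L by lra.
have m_le : (nceil (16 * L))%:R <= 17 * L by have := nceil_lt h16; lra.
have q_ge := le_nceil h32.
have Le : L <= expR L by have := expR_ge1Dx L; lra.
apply: (@le_trans _ _ (17 * L * expR (- (2 * L)))).
  apply: (ler_pM (ler0n _ _) (expR_ge0 _) m_le); rewrite ler_expR; lra.
have -> : - (2 * L) = - L + - L by ring.
have eL0 := expR_gt0 (- L).
have Ld : expR (- L) * d.+1%:R <= 2.
  case: d @L L1 h16 h32 m_le q_ge Le eL0 => [|d] L L1 h16 h32 m_le q_ge Le eL0.
    rewrite mulr1; apply: (@le_trans _ _ 1); last by rewrite ler1n.
    by rewrite -expR0 ler_expR; lra.
  have d0 : 0 < d.+1%:R :> R by rewrite ltr0n.
  have : expR (- L) <= d.+1%:R^-1.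
    by rewrite -[leRHS]lnK ?posrE ?invr_gt0 // ler_expR lnV ?posrE // lerN2 ln_le_log1.
  move=> h; apply: (@le_trans _ _ (d.+1%:R^-1 * d.+2%:R)).
    by rewrite ler_wpM2r.
  by rewrite ler_pdivrMl // -natrM ler_nat; lia.
rewrite ler_pdivlMr ?ltr0n // expRD.
have : L * expR (- L) <= 1.
  by rewrite expRN ler_pdivrMr ?expR_gt0 // mul1r.
set E := expR (- L) in eL0 Ld *; set x := d.+1%:R in Ld * => h.
have x0 : 0 <= x by rewrite /x ler0n.
have -> : 17 * L * (E * E) * x = 17 * ((L * E) * (E * x)) by ring.
have : (L * E) * (E * x) <= 1 * 2 by apply: ler_pM; rewrite ?mulr_ge0 //; lra.
lra.
Qed.

(** [(7 / 8) ^ m] is at most [expR (- (m / 8))], and [m / 8 >= 2 * L > ln d]. *)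
Lemma rounds_enough d (m := nceil (16 * log1 (d%:R : R))) :
  (d * 7 ^ m < 8 ^ m)%N.
Proof.
set L := log1 (d%:R : R) in m *; have L1 : 1 <= L by exact: log1_ge1.
have h16 : 0 <= 16 * L by lra.
have m_ge := le_nceil h16; rewrite -/m in m_ge.
case: (posnP d) => [->|d0]; first by rewrite mul0n expn_gt0.
have d0' : 0 < d%:R :> R by rewrite ltr0n.
rewrite -(ltr_nat R) natrM !natrX -[ltRHS]mul1r.
rewrite -ltr_pdivrMr ?exprn_gt0 // -mulrA -exprVn -exprMn.
apply: (@le_lt_trans _ _ (d%:R * expR (- (m%:R / 8)))).
  apply: ler_wpM2l; first exact: ltW.
  have -> : expR (- (m%:R / 8)) = expR (- 8^-1) ^+ m :> R.
    by rewrite -expRM_natl; congr expR; ring.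
  apply: lerXn2r; rewrite ?nnegrE ?divr_ge0 ?expR_ge0 //.
  by have := expR_ge1Dx (- 8^-1 : R); lra.
have one : d%:R * expR (- ln d%:R) = 1 :> R.
  by rewrite expRN lnK ?posrE // mulfV // gt_eqF.
rewrite -[ltRHS]one.
rewrite ltr_pM2l // ltr_expR.
by have := ln_le_log1 (d%:R : R); rewrite -/L; lra.
Qed.

End Guarantee.

Theorem theorem2p8 (R : realType) :
  exists (c c_rounds c_reps alpha C_size C : R) (eps : nat -> R),
    [/\ 0 < c, 0 < c_rounds, 0 < c_reps & 0 < alpha < 1] /\
    eps @ \oo --> (0 : R) /\
    forall (n d k : nat) (p : R) (A : 'M[R]_(n, d)),
      (0 < k)%N -> 1 <= p < 2 ->
      let r := sample_rank c p k in
      let rounds := nceil (c_rounds * log1 d%:R) in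
      let reps := nceil (c_reps * log1 d%:R) in
      forall (best : {set 'I_d} -> {set 'I_d} -> {set 'I_d})
             (pick : {set 'I_d} -> {ffun 'I_reps -> {set 'I_d}} -> 'I_reps),
        best_rule A p alpha best ->
        pick_rule A p best pick ->
        let output := column_sampling R r rounds best pick in
        (forall S : {set 'I_d}, 0 < output S ->
           #|S|%:R <= C_size * r%:R * log1 d%:R) /\
        1 - eps d <=
          Pr output (fun S =>
            let U := colset A S in
            forall V : 'M[R]_(#|S|, d), is_argmin A p U V ->
              pnorm p (U *m V - A) <=
                C * (r%:R `^ (p^-1 - 2^-1) * log1 k%:R `^ p^-1)
                  * opt_rank A p k).
Proof.
(* [768] is what the barrier argument requires and [8^-1] the fraction found by counting; [C_size]
   is [34 = 2 * 17], from at most [17 * log1 d] rounds selecting at most [2 * r] columns each. *)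
exists 768%:R, 16, 32, 8^-1, 34, (approx_const R), (fun d => 34 * d.+1%:R^-1).
split; [|split].
- split; rewrite ?ltr0n //; apply/andP; split; lra.
- rewrite -[0 : R](mulr0 34); apply: cvgMr; exact: cvg_harmonic.
move=> n d k p A k0 pb r rounds reps best pick bestP pickP output.
have L1 := log1_ge1 (d%:R : R).
split=> [S S_out|].
  have S_le : (#|S| <= rounds * (2 * r))%N.
    rewrite leqNgt; apply/negP => lt; move: S_out.
    by rewrite /output /column_sampling sampling_rounds_card ?ltxx // cards0.
  have h16 : 0 <= 16 * log1 (d%:R : R) by lra.
  have m_le : rounds%:R <= 17 * log1 d%:R :> R.
    by have := nceil_lt h16; rewrite -/rounds; lra.
  apply: (@le_trans _ _ (rounds%:R * (2 * r%:R))).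
    by rewrite -!natrM ler_nat.
  have : rounds%:R * (2 * r%:R) <= 17 * log1 d%:R * (2 * r%:R) :> R.
    by rewrite ler_wpM2r // mulr_ge0.
  by move/le_trans; apply; rewrite le_eqVlt; apply/orP; left; apply/eqP; ring.
have r0 : (0 < r)%N.
  by apply: leq_trans (sample_rank_ge p k); rewrite muln_gt0 k0.
pose K := approx_const R * (r%:R `^ (p^-1 - 2^-1) * log1 k%:R `^ p^-1).
have K0 : 0 < K.
  rewrite /K /approx_const; apply: mulr_gt0.
    by apply: mulr_gt0; [rewrite ltr0n | rewrite /log_const; lra].
  rewrite mulr_gt0 ?powR_gt0 ?ltr0n //; exact: lt_le_trans (log1_ge1 _).
(* The values attached to an outcome [S] are the errors of all its minimizers [V]. *)
have [B rB BP] := @opt_rank_approx R n d k A p K {set 'I_d} finset.set0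
  (fun S v => exists2 V : 'M[R]_(#|S|, d), is_argmin A p (colset A S) V &
                v = pnorm p (colset A S *m V - A)) K0.
have enough : (#|finset.setTfor 'I_d| * 7 ^ rounds < 8 ^ rounds)%N.
  rewrite cardsT card_ord; exact: rounds_enough.
have suc := sampling_success pb rB (sample_rank_ge p k) r0 bestP pickP
  finset.set0 enough.
apply: (@le_trans _ _ (1 - rounds%:R * expR (- (reps%:R / 16)))).
  by rewrite lerD2l lerN2; exact: failure_le.
apply: le_trans suc _; apply: Pr_mono => [S|S sS].
  exact: sampling_rounds_ge0.
move=> U V minV; apply: (BP S); last by exists V.
by move=> _ [V' minV' ->]; exact: success_bound.
Qed.
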